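(* Let $f$ be a strictly convex self-concordant function and suppose that the sequence $(\mathbf{x}_k)_{k\in\mathbb{N}}$ is generated by $\mathbf{x}_{k+1}=\mathbf{x}_k-t_k\mathbf{Q}_{h,k}^{-1}\nabla f(\mathbf{x}_k)$, where $\mathbf{Q}_{h,k}^{-1}$ is the truncated-SVD approximation of the inverse Hessian of $f$ at $\mathbf{x}_k$ defined in the context and $t_k$ is chosen by the backtracking (Armijo) line search described in the context. Suppose also that $\varepsilon\neq 0$. Then there exist $\gamma>0$ and $\eta\in\left(0,\frac{3-\sqrt5}{2}\right)$ such that, for every $k\in\mathbb{N}$: (i) if $\lambda(\mathbf{x}_k)>\eta$, then $f(\mathbf{x}_{k+1})-f(\mathbf{x}_k)\le-\gamma$; (ii) if $\lambda(\mathbf{x}_k)\le\eta$, then the line search selects the unit step $t_k=1$, and (a) if $\varepsilon\in(0,1)$, then the method achieves a composite convergence rate, i.e. $$\lambda(\mathbf{x}_{k+1})\le\frac{1-\varepsilon_{\min}+\lambda(\mathbf{x}_k)}{(1-\lambda(\mathbf{x}_k))^2}\,\lambda(\mathbf{x}_k)<\lambda(\mathbf{x}_k);$$ (b) if $\varepsilon=1$, then the method converges with at least super-linear rate, i.e. $$\frac{\lambda(\mathbf{x}_{k+1})}{\lambda(\mathbf{x}_k)}\le\frac{1-\varepsilon_k+\lambda(\mathbf{x}_k)}{(1-\lambda(\mathbf{x}_k))^2}.$$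
   Context: Function class. $f:\operatorname{dom}f\to\mathbb{R}$ with $\operatorname{dom}f\subseteq\mathbb{R}^n$ open and convex is three times continuously differentiable, strictly convex, and self-concordant with normalized constant $2$: for all $\mathbf{x}\in\operatorname{dom}f$, $\mathbf{u}\in\mathbb{R}^n$, the function $\phi(t)=f(\mathbf{x}+t\mathbf{u})$ satisfies $|\phi'''(t)|\le 2\,\phi''(t)^{3/2}$ for all $t$ with $\mathbf{x}+t\mathbf{u}\in\operatorname{dom}f$. Moreover $f$ has closed sublevel sets and is bounded below, so that a minimizer $\mathbf{x}^*$ exists; $f$ is taken to be $+\infty$ outside $\operatorname{dom} f$. The starting point is $\mathbf{x}_0\in\operatorname{dom}f$. Low-rank direction. Fix an integer $N$ with $1\le N<n$. Let $\sigma_{k,1}\ge\sigma_{k,2}\ge\dots\ge\sigma_{k,n}>0$ be the eigenvalues of $\nabla^2f(\mathbf{x}_k)$, let $\mathbf{\Sigma}_{k,N}=\operatorname{diag}(\sigma_{k,1},\dots,\sigma_{k,N})$ and let $\mathbf{U}_{k,N}\in\mathbb{R}^{n\times N}$ have as columns corresponding orthonormal eigenvectors. Define $$\mathbf{Q}_{h,k}^{-1}:=\sigma_{k,N+1}^{-1}\mathbf{I}_{n\times n}+\mathbf{U}_{k,N}\left(\mathbf{\Sigma}_{k,N}^{-1}-\sigma_{k,N+1}^{-1}\mathbf{I}_{N\times N}\right)\mathbf{U}_{k,N}^T,$$ so that the eigenvalues of $\mathbf{Q}_{h,k}^{-1}$ are $1/\sigma_{k,1},\dots,1/\sigma_{k,N},1/\sigma_{k,N+1},\dots,1/\sigma_{k,N+1}$.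 Write $\hat{\mathbf{d}}_{h,k}=-\mathbf{Q}_{h,k}^{-1}\nabla f(\mathbf{x}_k)$. Line search. With fixed $\alpha\in(0,0.5)$, $\beta\in(0,1)$: start with $t=1$; while $f(\mathbf{x}_k+t\hat{\mathbf{d}}_{h,k})>f(\mathbf{x}_k)+\alpha t\,\nabla f(\mathbf{x}_k)^T\hat{\mathbf{d}}_{h,k}$, replace $t$ by $\beta t$; then $t_k:=t$. Quantities. The Newton decrement is $\lambda(\mathbf{x}_k):=\left[\nabla f(\mathbf{x}_k)^T\nabla^2f(\mathbf{x}_k)^{-1}\nabla f(\mathbf{x}_k)\right]^{1/2}$; the iterates are assumed non-optimal, i.e. $\nabla f(\mathbf{x}_k)\ne 0$ (equivalently $\lambda(\mathbf{x}_k)>0$) for all $k$. Also $$\varepsilon_k:=\frac{\sigma_{k,n}}{\sigma_{k,N+1}},\qquad\varepsilon:=\liminf_{k\to\infty}\varepsilon_k,\qquad\varepsilon_{\min}:=\inf\{\varepsilon_k: k\in\mathbb{N}\}.$$ Super-linear rate means $\lambda(\mathbf{x}_{k+1})/\lambda(\mathbf{x}_k)\le R(k)$ with $R(k)\to0$. *)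

(* Defs.v *)
From HB Require Import structures.
From mathcomp Require Export all_boot all_order all_algebra.
From mathcomp Require Export all_classical all_reals all_analysis.

Set Implicit Arguments.
Unset Strict Implicit.
Unset Printing Implicit Defensive.

Import Order.TTheory GRing.Theory Num.Theory.
Export numFieldNormedType.Exports.

Local Open Scope classical_set_scope.
Local Open Scope ring_scope.

Definition dot (R : realType) (n : nat) (u v : 'cV[R]_n) : R :=
  (u^T *m v) ord0 ord0.

Section Calculus.
Context (R : realType) (n : nat).
Implicit Types (dom : set 'cV[R]_n) (f : 'cV[R]_n -> R) (x u : 'cV[R]_n).

Definition partial (i : 'I_n) f : 'cV[R]_n -> R :=
  fun x => 'D_(delta_mx i ord0) f x.

Definition gradient f x : 'cV[R]_n := \col_i partial i f x.

Definition hessian f x : 'M[R]_n := \matrix_(i, j) partial i (partial j f) x.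

(* Meant for open sets A, where {within A, continuous f} is continuity at
   every point of A and the derivatives do not see the values of f off A. *)
Fixpoint cont_diff (m : nat) (A : set 'cV[R]_n) f : Prop :=
  match m with
  | 0%N => {within A, continuous f}
  | m'.+1 => (forall x, A x -> differentiable f x) /\
             (forall i, cont_diff m' A (partial i f))
  end.

Definition strictly_convex_on dom f :=
  forall x y (s : R), dom x -> dom y -> x != y -> 0 < s < 1 ->
    f (s *: x + (1 - s) *: y) < s * f x + (1 - s) * f y.

Definition self_concordant_on dom f :=
  forall x u, dom x ->
    let phi : R -> R := fun t => f (x + t *: u) in
    forall t : R, dom (x + t *: u) ->
      `| derive1n 3 phi t | <= 2 * (derive1n 2 phi t) `^ (3 / 2).

(* f is total; only its values on dom matter. *)
Record sc_function dom f : Prop := {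
  sc_open : open dom;
  sc_convex_dom : convex_set dom;
  sc_C3 : cont_diff 3 dom f;
  sc_strictly_convex : strictly_convex_on dom f;
  sc_self_concordant : self_concordant_on dom f;
  sc_closed_sublevel : forall c : R, closed [set x | dom x /\ f x <= c];
  sc_bounded_below : has_lbound (f @` dom)
}.

Definition ext dom f : 'cV[R]_n -> \bar R :=
  fun x => if x \in dom then (f x)%:E else +oo%E.

Definition newton_decrement f x : R :=
  Num.sqrt (dot (gradient f x) (invmx (hessian f x) *m gradient f x)).

Definition armijo dom f (alpha : R) x d (t : R) :=
  (ext dom f (x + t *: d)%R <=
     (f x + alpha * t * dot (gradient f x) d)%:E)%E.

(* t is the output of: t := 1; while ~ armijo t do t := beta * t. *)
Definition backtracking dom f (alpha beta : R) x d (t : R) :=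
  exists m : nat,
    [/\ t = beta ^+ m, armijo dom f alpha x d (beta ^+ m) &
        forall j, (j < m)%N -> ~ armijo dom f alpha x d (beta ^+ j)].

End Calculus.

Section LowRank.
Context (R : realType) (n N : nat).
Implicit Types (H : 'M[R]_n) (sigma : nat -> R) (U : 'M[R]_(n, N)).

(* The eigenvalues sigma 1, ..., sigma n are numbered from 1 and listed with
   multiplicity; the other values of sigma are irrelevant. *)
Definition positive_spectrum H sigma :=
  [/\ char_poly H = \prod_(1 <= i < n.+1) ('X - (sigma i)%:P),
      forall i j, (1 <= i <= j)%N -> (j <= n)%N -> sigma j <= sigma i &
      0 < sigma n].

(* Column j : 'I_N of U belongs to the eigenvalue sigma j.+1. *)
Definition Sigma_N sigma : 'M[R]_N := diag_mx (\row_(j < N) sigma j.+1).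

Definition leading_eigenvectors H sigma U :=
  U^T *m U = 1%:M /\ H *m U = U *m Sigma_N sigma.

Definition Qinv sigma U : 'M[R]_n :=
  (sigma N.+1)^-1%:M +
  U *m (invmx (Sigma_N sigma) - (sigma N.+1)^-1%:M) *m U^T.

End LowRank.

(* Main.v *)
Require Import Defs.
From mathcomp Require Import all_boot all_order all_algebra.
From mathcomp Require Import all_classical all_reals all_analysis.
From mathcomp Require Import ring lra.
Import Order.TTheory GRing.Theory Num.Theory.
Import numFieldNormedType.Exports.
Local Open Scope classical_set_scope.
Local Open Scope ring_scope.
Set Implicit Arguments.
Unset Strict Implicit.
Unset Printing Implicit Defensive.

(** Write |v|_x for the local norm, the square root of v^T H(x) v with H the
    Hessian, lam for the Newton decrement at x_k, d for the truncated direction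
    and delta for the square root of g^T Q^-1 g = - g^T d, with g the gradient.

    Linear algebra.  H is symmetric, so the given leading eigenvectors extend
    to an orthonormal eigenbasis ([spectral_theorem_extending]) in which Q^-1 is
    diagonal as well ([lowrank_eigenbasis]).  The products of matching
    eigenvalues of H and Q^-1 lie between eps_k and 1, and coordinatewise
    comparison gives |d|_x <= delta <= lam, eps_k lam^2 <= delta^2, and a bound
    (1 - eps_k) lam on the dual local norm of g + H d, the amount by which d
    fails Newton's equation ([lowrank_estimates]).

    Self-concordance.  The hypothesis controls D^3 f[u, u, u] by 2 |u|^3.  The
    argument needs D^3 f[u, v, v] <= 2 |u| |v|^2 with the same constant
    ([third_form_mixed]); a loss in the constant would spoil the coefficient of
    lam^2 in the rate.  This is a statement about binary cubic forms, namely
    the Bernstein-Szego inequality for trigonometric polynomials of degree 3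
    ([cubic_form_mixed]).  Integrating along the segment from x to x + t d
    yields, as long as t r < 1 with r >= |d|_x, that the segment stays in the
    domain ([segment_in_dom]), that f exceeds its linear part by at most
    - t r - ln (1 - t r) ([segment_value]), that the ratio of the local
    norms at x + t d and at x lies between 1 - t r and its inverse
    ([segment_metric]), and that the linear model of the gradient errs by at
    most r^2 / (1 - r) in the dual norm at t = 1 ([segment_gradient]).

    Damped phase.  The value bound with r = delta makes Armijo's condition hold
    for all steps up to 1 / (1 + delta), so the accepted step is at least
    beta / (1 + delta) and f drops by at least
    alpha beta delta^2 / (1 + delta) ([backtracking_decrease]).  If lam > eta then delta exceeds
    sqrt(eps_min) eta, which gives a fixed gamma > 0; eps_min > 0 because
    eps <> 0 ([inf_range_gt0]).

    Unit-step phase.  For delta at most 1/2 - alpha and 1/2 the same bound accepts the step 1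
    ([backtracking_unit]).  The gradient bound with r = lam, read in the dual
    norm at x_{k+1}, gives lam_{k+1} <= ((1 - eps_k) lam + lam^2 / (1 - lam)) / (1 - lam)
    ([decrement_unit_step]), hence the composite rate.  For lam <= eta <= eps_min / 4
    the rate is below a constant q < 1, so the iterates stay in this phase and
    lam tends to 0; if moreover eps = 1, then eps_k tends to 1 and the rate
    tends to 0. *)

(** * Binary cubic forms *)

(** The angle of (x, y) divided by three, in algebraic form; it places the
    interpolation nodes below. *)
Lemma trisection (R : realType) (x y : R) : x ^+ 2 + y ^+ 2 = 1 ->
  exists c s : R, [/\ c ^+ 2 + s ^+ 2 = 1, x = 4 * c ^+ 3 - 3 * c &
    y = 3 * s - 4 * s ^+ 3].
Proof.
move=> xy1.
have xle : -1 <= x <= 1 by nra.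
pose th := acos x / 3.
have thx : acos x = th + th + th by rewrite /th; lra.
have cs1 : cos th ^+ 2 = 1 - sin th ^+ 2 by rewrite -(cos2Dsin2 th) addrK.
have cs1' : cos th ^+ 2 + sin th ^+ 2 = 1 := cos2Dsin2 th.
have cosx : x = 4 * cos th ^+ 3 - 3 * cos th.
  rewrite -[LHS](@acosK _ x) // thx !(cosD, sinD).
  ring: cs1.
have siny : (3 * sin th - 4 * sin th ^+ 3) ^+ 2 = y ^+ 2.
  have -> : y ^+ 2 = 1 - x ^+ 2 by lra.
  rewrite cosx.
  have -> : (3 * sin th - 4 * sin th ^+ 3) ^+ 2 =
    sin th ^+ 2 * (3 - 4 * sin th ^+ 2) ^+ 2 by ring.
  ring: cs1.
move/eqP: siny; rewrite eqf_sqr => /orP[] /eqP siny.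
  by exists (cos th), (sin th).
exists (cos th), (- sin th); split => //; first by rewrite sqrrN.
by rewrite -[y]opprK -siny; ring.
Qed.

(** Bernstein-Szego for homogeneous cubics.  With x = cos psi and y = sin psi,
    the value x P + y m is a convex combination of the values of the cubic at
    the angles psi / 3 + 2 pi j / 3 (j = 0, 1, 2), with weights
    (1 - 4 / 3 sin^2)^2 at these angles. *)
Lemma cubic_circle (R : realType) (P m k l M : R) :
  (forall c s : R, c ^+ 2 + s ^+ 2 = 1 ->
     `|P * c ^+ 3 + 3 * m * c ^+ 2 * s + 3 * k * c * s ^+ 2 + l * s ^+ 3|
       <= M) ->
  forall x y : R, x ^+ 2 + y ^+ 2 = 1 -> `|x * P + y * m| <= M.
Proof.
move=> bound x y /trisection[c [s [cs1 -> ->]]].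
pose r := Num.sqrt 3 : R.
have cs2 : c ^+ 2 = 1 - s ^+ 2 by rewrite -cs1 addrK.
have r2 : r ^+ 2 = 3 by rewrite sqr_sqrtr.
(* The nodes (c1, s1) and (c2, s2) are (c, s) rotated by 120 and -120 degrees. *)
pose c1 := - (c / 2) - r / 2 * s; pose s1 := - (s / 2) + r / 2 * c.
pose c2 := - (c / 2) + r / 2 * s; pose s2 := - (s / 2) - r / 2 * c.
have cs11 : c1 ^+ 2 + s1 ^+ 2 = 1 by rewrite /c1 /s1; field: r2 cs2.
have cs21 : c2 ^+ 2 + s2 ^+ 2 = 1 by rewrite /c2 /s2; field: r2 cs2.
have := bound _ _ cs1; have := bound _ _ cs11; have := bound _ _ cs21.
pose w (t : R) := ((3 - 4 * t ^+ 2) / 3) ^+ 2.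
pose q (c s : R) :=
  P * c ^+ 3 + 3 * m * c ^+ 2 * s + 3 * k * c * s ^+ 2 + l * s ^+ 3.
rewrite -/(q c s) -/(q c1 s1) -/(q c2 s2) => b2 b1 b0.
have w1 : w s + w s1 + w s2 = 1.
  by rewrite /w /s1 /s2; field: r2 cs2.
have -> : (4 * c ^+ 3 - 3 * c) * P + (3 * s - 4 * s ^+ 3) * m =
   w s * q c s + w s1 * q c1 s1 + w s2 * q c2 s2.
  by rewrite /w /q /c1 /s1 /c2 /s2; field: r2 cs2.
have w0 t : 0 <= w t by rewrite sqr_ge0.
have -> : M = w s * M + w s1 * M + w s2 * M by rewrite -!mulrDl w1 mul1r.
apply: le_trans (ler_normD _ _) _; apply: lerD; last first.
  by rewrite normrM ger0_norm // ler_wpM2l.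
apply: le_trans (ler_normD _ _) _; apply: lerD.
  by rewrite normrM ger0_norm // ler_wpM2l.
by rewrite normrM ger0_norm // ler_wpM2l.
Qed.

(** For a positive definite quadratic form, an orthonormal frame reduces the
    claim to the circle: c is the cubic polarized at (1, 0), (0, 1), (0, 1), and
    the first vector makes with the second the angle whose cosine is
    F / sqrt(E G). *)
Lemma cubic_form_mixed_pd (R : realType) (a b c e E F G : R) :
  0 < G -> F ^+ 2 < E * G ->
  (forall s t : R, (a * s ^+ 3 + 3 * b * s ^+ 2 * t + 3 * c * s * t ^+ 2
      + e * t ^+ 3) ^+ 2
    <= 4 * (E * s ^+ 2 + 2 * F * s * t + G * t ^+ 2) ^+ 3) ->
  c ^+ 2 <= 4 * E * G ^+ 2.
Proof.
move=> G0 FEG bound.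
have E0 : 0 < E by rewrite -(pmulr_lgt0 _ G0); apply: le_lt_trans FEG; nra.
pose sE := Num.sqrt E; pose sG := Num.sqrt G; pose sD := Num.sqrt (E * G - F ^+ 2).
have sE2 : E = sE ^+ 2 by rewrite sqr_sqrtr // ltW.
have sG2 : G = sG ^+ 2 by rewrite sqr_sqrtr // ltW.
have sD2 : sD ^+ 2 = E * G - F ^+ 2 by rewrite sqr_sqrtr // subr_ge0 ltW.
have sE0 : 0 < sE by rewrite sqrtr_gt0.
have sG0 : 0 < sG by rewrite sqrtr_gt0.
have sD0 : 0 < sD by rewrite sqrtr_gt0 subr_gt0.
have sEn := lt0r_neq0 sE0; have sGn := lt0r_neq0 sG0; have sDn := lt0r_neq0 sD0.
(* The frame consists of v / sG and (G u - F v) / (sG sD) for u = (1, 0) and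
   v = (0, 1); P, m, k and l are the coefficients of the cubic in it. *)
pose A s t := a * s ^+ 3 + 3 * b * s ^+ 2 * t + 3 * c * s * t ^+ 2 + e * t ^+ 3.
pose P := e / sG ^+ 3.
pose m := (G * c - F * e) / (sG ^+ 3 * sD).
pose k := (G ^+ 2 * b - 2 * G * F * c + F ^+ 2 * e) / (sG ^+ 3 * sD ^+ 2).
pose l := A G (- F) / (sG ^+ 3 * sD ^+ 3).
have circ c1 s1 : c1 ^+ 2 + s1 ^+ 2 = 1 ->
   `|P * c1 ^+ 3 + 3 * m * c1 ^+ 2 * s1 + 3 * k * c1 * s1 ^+ 2 + l * s1 ^+ 3|
     <= 2.
  move=> cs1.
  have := bound (s1 * sG / sD) (c1 / sG - s1 * F / (sG * sD)).
  have -> : E * (s1 * sG / sD) ^+ 2 +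
      2 * F * (s1 * sG / sD) * (c1 / sG - s1 * F / (sG * sD)) +
      G * (c1 / sG - s1 * F / (sG * sD)) ^+ 2 = 1.
    transitivity ((E * G - F ^+ 2) / sD ^+ 2 * s1 ^+ 2 + c1 ^+ 2); last first.
      by rewrite -sD2 divff ?sqrf_eq0 // mul1r addrC.
    by rewrite sG2; field; rewrite sGn sDn.
  have -> : a * (s1 * sG / sD) ^+ 3 +
      3 * b * (s1 * sG / sD) ^+ 2 * (c1 / sG - s1 * F / (sG * sD)) +
      3 * c * (s1 * sG / sD) * (c1 / sG - s1 * F / (sG * sD)) ^+ 2 +
      e * (c1 / sG - s1 * F / (sG * sD)) ^+ 3 =
      P * c1 ^+ 3 + 3 * m * c1 ^+ 2 * s1 + 3 * k * c1 * s1 ^+ 2 + l * s1 ^+ 3.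
    by rewrite /P /m /k /l /A sG2; field; rewrite sGn sDn.
  by move=> h; rewrite -ler_sqr ?nnegrE // real_normK ?num_real //; lra.
have xy1 : (F / (sE * sG)) ^+ 2 + (sD / (sE * sG)) ^+ 2 = 1.
  by rewrite !expr_div_n -mulrDl sD2 addrC subrK exprMn -sE2 -sG2 divff //
    mulf_neq0 ?lt0r_neq0.
have := cubic_circle circ xy1.
have -> : F / (sE * sG) * P + sD / (sE * sG) * m = c / (sE * G).
  by rewrite /P /m sG2; field; rewrite sEn sGn sDn.
rewrite normrM normfV [`|sE * G|]gtr0_norm ?mulr_gt0 // ler_pdivrMr ?mulr_gt0 //.
move=> h; rewrite -[c ^+ 2]real_normK ?num_real //.
have -> : 4 * E * G ^+ 2 = (2 * (sE * G)) ^+ 2 by rewrite sE2; ring.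
by rewrite ler_sqr ?nnegrE // mulr_ge0 // mulr_ge0 // ltW.
Qed.

(** The degenerate case follows by adding d (s^2 + t^2) to the quadratic form;
    degeneracy cannot be excluded where this is used, since positivity of the
    Hessian away from the current iterate is itself derived from it. *)
Lemma cubic_form_mixed (R : realType) (a b c e E F G : R) :
  0 <= E -> 0 <= G -> F ^+ 2 <= E * G ->
  (forall s t : R, (a * s ^+ 3 + 3 * b * s ^+ 2 * t + 3 * c * s * t ^+ 2
      + e * t ^+ 3) ^+ 2
    <= 4 * (E * s ^+ 2 + 2 * F * s * t + G * t ^+ 2) ^+ 3) ->
  c ^+ 2 <= 4 * E * G ^+ 2.
Proof.
move=> E0 G0 FEG bound.
have q0 s t : 0 <= E * s ^+ 2 + 2 * F * s * t + G * t ^+ 2.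
  have [E00|Ep] := eqVneq E 0; last first.
    have Ep' : 0 < E by rewrite lt0r Ep.
    rewrite -(pmulr_rge0 _ Ep'); have : 0 <= (E * s + F * t) ^+ 2 + (E * G - F ^+ 2) * t ^+ 2.
      by rewrite addr_ge0 ?sqr_ge0 // mulr_ge0 ?sqr_ge0 // subr_ge0.
    by congr (_ <= _); ring.
  have -> : F = 0.
    by apply/eqP; rewrite -sqrf_eq0 eq_le sqr_ge0 andbT; move: FEG; rewrite E00 mul0r.
  by rewrite E00 mul0r mulr0 !mul0r !add0r mulr_ge0 ?sqr_ge0.
have pd d : 0 < d -> c ^+ 2 <= 4 * (E + d) * (G + d) ^+ 2.
  move=> d0; apply: (@cubic_form_mixed_pd _ a b c e _ F).
  - by lra.
  - by nra.
  - move=> s t; apply: le_trans (bound s t) _; rewrite ler_pM2l //.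
    by apply: lerXn2r; rewrite ?nnegrE //; have := q0 s t; nra.
(* polynomial in d, so let d tend to 0 *)
apply/ler_addgt0Pl => z z0.
pose K := 4 * (2 * E * G + G ^+ 2 + E + 2 * G + 1).
have K0 : 0 < K by rewrite /K; nra.
pose d := Num.min 1 (z / K).
have d0 : 0 < d by rewrite lt_min ltr01 divr_gt0.
have d1 : d <= 1 by rewrite ge_min lexx.
have dK : d * K <= z by rewrite -ler_pdivlMr // ge_min lexx orbT.
apply: le_trans (pd d d0) _.
have -> : 4 * (E + d) * (G + d) ^+ 2 = 4 * E * G ^+ 2 + d * K
   - 4 * (d * (1 - d)) * (E + 2 * G + 1 + d).
  by rewrite /K; ring.
have : 0 <= d * (1 - d) * (E + 2 * G + 1 + d).
  by rewrite mulr_ge0 //; [rewrite mulr_ge0 ?subr_ge0 // ltW | lra].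
lra.
Qed.

(** * Orthogonal diagonalization adapted to given eigenvectors *)

Lemma cvdot_gt0 (R : realDomainType) n (v : 'cV[R]_n) :
  v != 0 -> 0 < (v^T *m v) ord0 ord0.
Proof.
move=> vn0; rewrite lt0r mxE; under eq_bigr do rewrite mxE -expr2.
rewrite sumr_ge0 ?andbT => [|i _]; last exact: sqr_ge0.
apply: contra vn0 => /eqP/psumr_eq0P v0; apply/eqP/colP => i; rewrite mxE.
by apply/eqP; rewrite -sqrf_eq0; apply/eqP/v0 => // j _; exact: sqr_ge0.
Qed.

(** The Householder reflection exchanging v and the first basis vector. *)
Lemma reflection_to (R : realFieldType) m (v : 'cV[R]_(1 + m)) :
  v^T *m v = 1%:M ->
  exists P : 'M[R]_(1 + m),
    [/\ P^T = P, P *m P = 1%:M & P *m col_mx 1%:M 0 = v].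
Proof.
move=> v1; pose e : 'cV[R]_(1 + m) := col_mx 1%:M 0.
have e1 : e^T *m e = 1%:M.
  by rewrite tr_col_mx mul_row_col trmx1 trmx0 mulmx1 mulmx0 addr0.
have [->|ve] := eqVneq v e.
  by exists 1%:M; rewrite trmx1 !mul1mx.
pose z := v - e; pose a := (z^T *m z) ord0 ord0.
have a0 : a != 0 by rewrite gt_eqF // cvdot_gt0 // subr_eq0.
have za : z^T *m z = a%:M by rewrite [LHS]mx11_scalar.
have ev : v^T *m e = e^T *m v.
  by rewrite -[LHS]trmxK trmx_mul trmxK [RHS]mx11_scalar [X in X^T]mx11_scalar tr_scalar_mx.
have ze : (z^T *m e) = (- (a / 2))%:M.
  have : z^T *m z = - 2%:R *: (z^T *m e).
    rewrite /z [(v - e)^T]linearB /= !mulmxBl !mulmxBr v1 e1 ev.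
    by rewrite opprB !scalerBr scaleNr -!scaleNr !opprK; apply/matrixP => i j; rewrite !mxE; ring.
  rewrite za => /(congr1 (fun M => (- 2%:R)^-1 *: M)).
  rewrite scalerA mulVf ?scale1r ?oppr_eq0 ?pnatr_eq0 //.
  by move=> <-; rewrite scale_scalar_mx; congr (_%:M); field.
exists (1%:M - (2 / a) *: (z *m z^T)); split.
- by rewrite linearB /= trmx1 linearZ /= trmx_mul trmxK.
- rewrite mulmxBl mul1mx mulmxBr mulmx1 -!scalemxAl -!scalemxAr.
  rewrite mulmxA -[z *m z^T *m z]mulmxA za mul_mx_scalar -scalemxAl scalerA.
  rewrite divfK //; move: (2 / a) => c.
  by rewrite scalerA mulrC -scalerA scaler_nat mulr2n opprB addrK subrK.
- rewrite mulmxBl mul1mx -scalemxAl -mulmxA ze mul_mx_scalar scalerA.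
  have -> : 2 / a * - (a / 2) = -1 by field.
  by rewrite scaleN1r opprK addrC subrK.
Qed.

Lemma char_poly_conj (R : comNzRingType) n (P Q A : 'M[R]_n) :
  Q *m P = 1%:M -> char_poly (Q *m A *m P) = char_poly A.
Proof.
move=> QP; rewrite /char_poly.
have -> : char_poly_mx (Q *m A *m P) =
    map_mx polyC Q *m char_poly_mx A *m map_mx polyC P.
  rewrite /char_poly_mx !map_mxM mulmxBr mulmxBl; congr (_ - _).
  by rewrite scalar_mxC -mulmxA -map_mxM QP map_mx1 mulmx1.
rewrite !det_mulmx mulrC mulrA -det_mulmx mulmx1C -?map_mxM ?QP ?map_mx1 //.
by rewrite det1 mul1r.
Qed.

(** A unit eigenvector splits off: reflecting it onto the first basis vector
    makes the symmetric matrix block diagonal. *)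
Lemma deflation (R : realFieldType) m (H : 'M[R]_(1 + m)) (s : 'I_(1 + m) -> R)
    (v : 'cV[R]_(1 + m)) :
  H^T = H -> char_poly H = \prod_(i < 1 + m) ('X - (s i)%:P) ->
  v^T *m v = 1%:M -> H *m v = s ord0 *: v ->
  exists (P : 'M[R]_(1 + m)) (B : 'M[R]_m),
    [/\ [/\ P^T = P, P *m P = 1%:M & P *m col_mx 1%:M 0 = v],
        H = P *m block_mx (s ord0)%:M 0 0 B *m P, B^T = B &
        char_poly B = \prod_(i < m) ('X - (s (lift ord0 i))%:P)].
Proof.
move=> symH chH v1 Hv; have [P [symP PP Pe]] := reflection_to v1.
pose H' := P *m H *m P.
have symH' : H'^T = H' by rewrite /H' !trmx_mul symP symH mulmxA.
have H'e : H' *m col_mx 1%:M 0 = s ord0 *: col_mx 1%:M 0.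
  by rewrite /H' -mulmxA Pe -mulmxA Hv -scalemxAr -Pe mulmxA PP mul1mx.
have ul : ulsubmx H' = (s ord0)%:M /\ dlsubmx H' = 0.
  move: H'e; rewrite -[in LHS](submxK H') mul_block_col !mulmx1 !mulmx0 !addr0.
  by rewrite scale_col_mx scaler0 scalemx1 => /eq_col_mx.
have H'E : H' = block_mx (s ord0)%:M 0 0 (drsubmx H').
  rewrite -[LHS]submxK; have [-> dl] := ul; rewrite dl; congr (block_mx _ _ _ _).
  by rewrite -[in LHS]symH' -trmx_dlsub dl trmx0.
exists P, (drsubmx H'); split => //.
- by rewrite -H'E /H' !mulmxA PP mul1mx -mulmxA PP mulmx1.
- by rewrite trmx_drsub symH'.
have : char_poly H' = \prod_(i < 1 + m) ('X - (s i)%:P).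
  by rewrite /H' char_poly_conj.
rewrite (congr1 char_poly H'E).
rewrite /char_poly char_block_diag_mx det_ublock big_ord_recl.
rewrite {1}/char_poly_mx map_scalar_mx -raddfB /= det_scalar1.
by apply: mulfI; rewrite polyXsubC_eq0.
Qed.

Lemma eigenvector_of_sym (R : rcfType) n (H : 'M[R]_n) (a : R) :
  H^T = H -> root (char_poly H) a ->
  exists v : 'cV[R]_n, v^T *m v = 1%:M /\ H *m v = a *: v.
Proof.
move=> symH; rewrite -eigenvalue_root_char => /eigenvalueP[u Hu un0].
have u0 : 0 < (u *m u^T) ord0 ord0.
  by rewrite -{1}[u]trmxK cvdot_gt0 // trmx_eq0.
pose c := Num.sqrt ((u *m u^T) ord0 ord0).
have c0 : c != 0 by rewrite gt_eqF // sqrtr_gt0.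
exists (c^-1 *: u^T); split; last first.
  by rewrite -scalemxAr -{1}symH -trmx_mul Hu linearZ /= !scalerA mulrC.
rewrite [(_ *: _)^T]linearZ /= trmxK -scalemxAl -scalemxAr [u *m u^T]mx11_scalar !scale_scalar_mx.
congr (_%:M); rewrite -(sqr_sqrtr (ltW u0)) -/c; by field.
Qed.

(** Induction on the dimension by deflation.  While prescribed eigenvectors
    remain, the first one is split off, and the others, being orthogonal to it,
    descend to the complementary block; afterwards any eigenvector will do,
    which exists because the characteristic polynomial splits. *)
Lemma spectral_theorem_extending (R : rcfType) n N (leNn : (N <= n)%N)
    (H : 'M[R]_n) (s : 'I_n -> R) (U : 'M[R]_(n, N)) :
  H^T = H -> char_poly H = \prod_(i < n) ('X - (s i)%:P) ->
  U^T *m U = 1%:M ->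
  H *m U = U *m diag_mx (\row_j s (widen_ord leNn j)) ->
  exists V : 'M[R]_n,
    [/\ V^T *m V = 1%:M, H *m V = V *m diag_mx (\row_i s i) &
        forall j, col j U = col (widen_ord leNn j) V].
Proof.
elim: n N leNn H s U => [|m IH] N leNn H s U symH chH U1 HU.
  exists 0; split; try by rewrite [LHS]flatmx0 [RHS]flatmx0.
  by move=> j; rewrite [LHS]flatmx0 [RHS]flatmx0.
pose s' i := s (lift ord0 i).
have Dblock : diag_mx (\row_i s i) =
    block_mx (s ord0)%:M 0 0 (diag_mx (\row_i s' i)) :> 'M[R]_(1 + m).
  apply/matrixP => i j.
  case: (split_ordP i) => i' ->; case: (split_ordP j) => j' ->.
  - by rewrite block_mxEul !mxE !ord1; congr (s _ *+ _); apply: val_inj.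
  - by rewrite block_mxEur !mxE; case: eqP => // /(congr1 val) /=; rewrite ord1.
  - by rewrite block_mxEdl !mxE; case: eqP => // /(congr1 val) /=; rewrite ord1.
  - rewrite block_mxEdr !mxE -!val_eqE /= ?add1n ?eqSS.
    by congr (s _ *+ _); apply: val_inj.
have assemble (P : 'M[R]_(1 + m)) (B W : 'M[R]_m) :
    P^T = P -> P *m P = 1%:M -> H = P *m block_mx (s ord0)%:M 0 0 B *m P ->
    W^T *m W = 1%:M -> B *m W = W *m diag_mx (\row_i s' i) ->
    let V := P *m (block_mx 1%:M 0 0 W : 'M[R]_(1 + m)) in
    V^T *m V = 1%:M /\ H *m V = V *m diag_mx (\row_i s i).
  move=> symP PP HE W1 BW V; split.
    rewrite /V trmx_mul symP mulmxA -[_ *m P *m P]mulmxA PP mulmx1.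
    rewrite tr_block_mx mulmx_block trmx1 !trmx0 !(mulmx0, mul0mx, mulmx1, addr0, add0r) W1.
    by rewrite -scalar_mx_block.
  rewrite /V {1}HE mulmxA -[_ *m P *m P]mulmxA PP mulmx1 Dblock -!mulmxA.
  congr (P *m _); etransitivity; first exact: mulmx_block.
  apply/esym; etransitivity; first exact: mulmx_block.
  by rewrite !(mulmx0, mul0mx, mulmx1, mul1mx, addr0, add0r) BW.
case: N leNn U U1 HU => [|N] leNn U U1 HU.
  have rt : root (char_poly H) (s ord0).
    by rewrite chH big_ord_recl rootM root_XsubC eqxx.
  have [v [v1 Hv]] := eigenvector_of_sym symH rt.
  have [P [B [[symP PP Pe] HE symB chB]]] := deflation symH chH v1 Hv.
  have [||W [W1 BW _]] := IH 0%N (leq0n _) B s' 0 symB chB.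
  - by rewrite [LHS]flatmx0 [RHS]flatmx0.
  - by rewrite [LHS]thinmx0 [RHS]thinmx0.
  have [V1 HV] := assemble P B W symP PP HE W1 BW.
  by eexists; split; [exact: V1 | exact: HV | case].
pose v := col ord0 U.
have v1 : v^T *m v = 1%:M.
  rewrite [LHS]mx11_scalar; congr (_%:M).
  have -> : (v^T *m v) ord0 ord0 = (U^T *m U) ord0 ord0.
    by rewrite !mxE; apply: eq_bigr => i _; rewrite !mxE.
  by rewrite U1 mxE eqxx.
have Hv : H *m v = s ord0 *: v.
  rewrite /v colE mulmxA HU -!colE; apply/colP => i.
  rewrite mxE mul_mx_diag !mxE mulrC; congr (s _ * _); exact: val_inj.
have [P [B [[symP PP Pe] HE symB chB]]] := deflation symH chH v1 Hv.
pose PU : 'M[R]_(1 + m, 1 + N) := P *m U.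
have PU1 : PU^T *m PU = 1%:M.
  by rewrite /PU trmx_mul symP mulmxA -[_ *m P *m P]mulmxA PP mulmx1.
have PUe : lsubmx PU = col_mx 1%:M 0.
  have -> : lsubmx PU = P *m v.
    apply/colP => i; rewrite !mxE; apply: eq_bigr => j _; rewrite !mxE.
    by congr (_ * U _ _); apply: val_inj.
  by rewrite -Pe mulmxA PP mul1mx.
have ul : ulsubmx PU = 1%:M 
  by have := congr1 usubmx PUe; rewrite col_mxKu => <-; apply/matrixP => i j; rewrite !mxE.
have dl : dlsubmx PU = 0 
  by have := congr1 dsubmx PUe; rewrite col_mxKd => <-; apply/matrixP => i j; rewrite !mxE.
pose U' := drsubmx PU.
have ur : ursubmx PU = 0.
  move: PU1; rewrite -{1 2}[PU]submxK ul dl tr_block_mx mulmx_block trmx1 trmx0.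
  rewrite mul1mx !mul0mx addr0 scalar_mx_block.
  by case/eq_block_mx => _; rewrite mul1mx addr0.
have PUE : PU = block_mx 1%:M 0 0 U' by rewrite -[LHS]submxK ul dl ur.
have UE : U = P *m (block_mx 1%:M 0 0 U' : 'M[R]_(1 + m, 1 + N)).
  by rewrite -PUE /PU mulmxA PP mul1mx.
have U'1 : U'^T *m U' = 1%:M.
  move: PU1; rewrite PUE tr_block_mx mulmx_block scalar_mx_block.
  by case/eq_block_mx => _ _ _; rewrite trmx0 mul0mx add0r.
have leNm : (N <= m)%N by [].
have BU' : B *m U' = U' *m diag_mx (\row_j s' (widen_ord leNm j)).
  have : block_mx (s ord0)%:M 0 0 B *m PU = PU *m diag_mx (\row_j s (widen_ord leNn j)).
    by rewrite /PU -mulmxA -HU {1}HE !mulmxA PP mul1mx.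
  have -> : diag_mx (\row_j s (widen_ord leNn j)) =
    block_mx (s ord0)%:M 0 0 (diag_mx (\row_j s' (widen_ord leNm j))) :> 'M[R]_(1 + N).
    apply/matrixP => i j.
    case: (split_ordP i) => i' ->; case: (@split_ordP 1 N j) => j' ->.
    - by rewrite block_mxEul !mxE !ord1; congr (s _ *+ _); apply: val_inj.
    - by rewrite block_mxEur !mxE; case: eqP => // /(congr1 val) /=; rewrite ord1.
    - by rewrite block_mxEdl !mxE; case: eqP => // /(congr1 val) /=; rewrite ord1.
    - rewrite block_mxEdr !mxE -!val_eqE /= ?add1n ?eqSS.
      by congr (s _ *+ _); apply: val_inj.
  rewrite PUE mulmx_block => eqB.
  have /eq_block_mx[_ _ _] := etrans eqB (mulmx_block _ _ _ _ _ _ _ _).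
  by rewrite !mulmx0 !add0r.
have [W [W1 BW UW]] := IH N leNm B s' U' symB chB U'1 BU'.
have [V1 HV] := assemble P B W symP PP HE W1 BW.
eexists; split; [exact: V1 | exact: HV | move=> j].
rewrite UE !colE -!mulmxA -!colE; congr (P *m _).
apply/colP => i; rewrite [LHS]mxE [RHS]mxE.
case: (split_ordP i) => i' ->; case: (@split_ordP 1 N j) => j' ->.
- have -> : widen_ord leNn (lshift N j') = lshift m (ord0 : 'I_1) :> 'I_(1 + m).
    by apply: val_inj; rewrite /= ord1.
  etransitivity; first exact: block_mxEul.
  apply/esym; etransitivity; first exact: block_mxEul.
  by rewrite !mxE !ord1.
- have -> : widen_ord leNn (rshift 1 j') = rshift 1 (widen_ord leNm j') :> 'I_(1 + m).
    by apply: val_inj.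
  etransitivity; first exact: block_mxEur.
  apply/esym; etransitivity; first exact: block_mxEur.
  by rewrite !mxE.
- have -> : widen_ord leNn (lshift N j') = lshift m (ord0 : 'I_1) :> 'I_(1 + m).
    by apply: val_inj; rewrite /= ord1.
  etransitivity; first exact: block_mxEdl.
  apply/esym; etransitivity; first exact: block_mxEdl.
  by rewrite !mxE.
- have -> : widen_ord leNn (rshift 1 j') = rshift 1 (widen_ord leNm j') :> 'I_(1 + m).
    by apply: val_inj.
  etransitivity; first exact: block_mxEdr.
  apply/esym; etransitivity; first exact: block_mxEdr.
  by have /colP/(_ i') := UW j'; rewrite !mxE.
Qed.

(** * The truncated inverse in a common eigenbasis *)

Lemma dotC (R : realType) n (u v : 'cV[R]_n) : dot u v = dot v u.
Proof. by rewrite /dot !mxE; apply: eq_bigr => i _; rewrite !mxE mulrC. Qed.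

Lemma dotE (R : realType) n (u v : 'cV[R]_n) :
  dot u v = \sum_i u i ord0 * v i ord0.
Proof. by rewrite /dot mxE; apply: eq_bigr => i _; rewrite mxE. Qed.

Lemma dotDr (R : realType) n (u v w : 'cV[R]_n) :
  dot u (v + w) = dot u v + dot u w.
Proof. by rewrite /dot mulmxDr mxE. Qed.

Lemma dotNr (R : realType) n (u v : 'cV[R]_n) : dot u (- v) = - dot u v.
Proof. by rewrite /dot mulmxN mxE. Qed.

Lemma dotZr (R : realType) n a (u v : 'cV[R]_n) : dot u (a *: v) = a * dot u v.
Proof. by rewrite /dot -scalemxAr mxE. Qed.

Lemma dotNl (R : realType) n (u v : 'cV[R]_n) : dot (- u) v = - dot u v.
Proof. by rewrite dotC dotNr dotC. Qed.

Lemma dot_eigenbasis (R : realType) n (V : 'M[R]_n) (d : 'I_n -> R)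
    (u v : 'cV[R]_n) :
  dot u (V *m diag_mx (\row_i d i) *m V^T *m v) =
  \sum_i d i * (V^T *m u) i ord0 * (V^T *m v) i ord0.
Proof.
rewrite /dot -!mulmxA mulmxA -[u^T *m V]trmxK trmx_mul trmxK.
rewrite mxE; apply: eq_bigr => i _.
by rewrite mul_diag_mx !mxE mulrCA mulrA.
Qed.

Lemma sum_cauchy_schwarz (R : realFieldType) n (x y : 'I_n -> R) :
  (\sum_i x i * y i) ^+ 2 <= (\sum_i x i ^+ 2) * (\sum_i y i ^+ 2).
Proof.
set B := \sum_i _; set S := \sum_i _; set T := \sum_i _.
have T0 : 0 <= T by apply: sumr_ge0 => i _; exact: sqr_ge0.
have [T_eq0|Tn0] := eqVneq T 0.
  have y0 i : y i = 0.
    have /psumr_eq0P y20 := T_eq0.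
    by apply/eqP; rewrite -sqrf_eq0 y20 // => j _; exact: sqr_ge0.
  rewrite T_eq0 mulr0 /B big1 ?expr0n // => i _.
  by rewrite y0 mulr0.
have Tp : 0 < T by rewrite lt0r Tn0.
rewrite -subr_ge0 -(pmulr_rge0 _ Tp).
have -> : T * (S * T - B ^+ 2) = \sum_i (T * x i - B * y i) ^+ 2.
  transitivity (T ^+ 2 * S - 2 * T * B * B + B ^+ 2 * T); first by ring.
  have -> : T ^+ 2 * S = \sum_i T ^+ 2 * x i ^+ 2 by rewrite mulr_sumr.
  have -> : 2 * T * B * B = \sum_i 2 * T * B * (x i * y i) by rewrite mulr_sumr.
  have -> : B ^+ 2 * T = \sum_i B ^+ 2 * y i ^+ 2 by rewrite mulr_sumr.
  by rewrite -sumrB -big_split /=; apply: eq_bigr => i _; ring.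
by apply: sumr_ge0 => i _; exact: sqr_ge0.
Qed.

(** Extending the columns of U to an orthonormal eigenbasis diagonalizes the
    Hessian and the truncated inverse simultaneously. *)
Lemma lowrank_eigenbasis (R : realType) n N (H : 'M[R]_n) (sigma : nat -> R)
    (U : 'M[R]_(n, N)) :
  (0 < N < n)%N -> H^T = H -> positive_spectrum H sigma ->
  leading_eigenvectors H sigma U ->
  exists (V : 'M[R]_n) (s p : 'I_n -> R),
    [/\ V^T *m V = 1%:M, H = V *m diag_mx (\row_i s i) *m V^T,
        Qinv sigma U = V *m diag_mx (\row_i p i) *m V^T &
        forall i, [/\ 0 < s i, 0 < p i & sigma n / sigma N.+1 <= s i * p i <= 1]].
Proof.
case/andP=> N0 ltNn symH [chH mono sn0] [U1 HU].
have leNn : (N <= n)%N by exact: ltnW.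
pose s (i : 'I_n) := sigma i.+1.
have sig0 j : (0 < j <= n)%N -> 0 < sigma j.
  by case/andP=> j0 jn; apply: lt_le_trans sn0 _; apply: mono; rewrite ?j0 //= ltnW.
have chH' : char_poly H = \prod_(i < n) ('X - (s i)%:P).
  by rewrite chH big_add1 big_mkord.
have HU' : H *m U = U *m diag_mx (\row_j s (widen_ord leNn j)) by rewrite HU.
have [V [V1 HV UV]] := spectral_theorem_extending symH chH' U1 HU'.
have VV1 : V *m V^T = 1%:M by exact: mulmx1C.
pose a := (sigma N.+1)^-1.
pose p (i : 'I_n) := if (i < N)%N then (s i)^-1 else a.
exists V, s, p; split => //.
- by rewrite -HV -mulmxA VV1 mulmx1.
- have -> : Qinv sigma U = V *m (V^T *m Qinv sigma U *m V) *m V^T.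
    by rewrite !mulmxA VV1 mul1mx -mulmxA VV1 mulmx1.
  congr (V *m _ *m _); rewrite /Qinv mulmxDr mulmxDl.
  rewrite scalar_mxC -[_%:M *m V^T *m V]mulmxA V1 mulmx1.
  have VU i j : (V^T *m U) i j = (i == widen_ord leNn j)%:R.
    have -> : (V^T *m U) i j = (V^T *m V) i (widen_ord leNn j).
      rewrite !mxE; apply: eq_bigr => k _.
      by have /colP/(_ k) := UV j; rewrite !mxE => ->.
    by rewrite V1 mxE.
  have SN : invmx (Sigma_N N sigma) = diag_mx (\row_(j < N) (sigma j.+1)^-1).
    have SS : Sigma_N N sigma *m diag_mx (\row_(j < N) (sigma j.+1)^-1) = 1%:M.
      apply/matrixP => i j; rewrite /Sigma_N mul_diag_mx !mxE.
      case: eqP => [->|]; last by rewrite mulr0.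
      by rewrite divff // gt_eqF // sig0 //= (leq_trans _ leNn).
    have Su : Sigma_N N sigma \in unitmx by case/mulmx1_unit: SS.
    by rewrite -[LHS]mulmx1 -SS mulKmx.
  rewrite SN -mulmxA -[_ *m U^T *m V]mulmxA.
  have -> : U^T *m V = (V^T *m U)^T by rewrite trmx_mul trmxK.
  have -> : diag_mx (\row_(j < N) (sigma j.+1)^-1) - ((sigma N.+1)^-1)%:M =
      diag_mx (\row_(j < N) ((sigma j.+1)^-1 - a)).
    by apply/matrixP => i j; rewrite !mxE -mulrnBl.
  rewrite !mulmxA; move: (V^T *m U) VU => E VU.
  apply/matrixP => i k; rewrite !mxE.
  under eq_bigr => j _ do rewrite mul_mx_diag !mxE !VU.
  have [iN|iN] := ltnP i N; last first.
    rewrite big1 ?addr0 => [|j _]; last first.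
      case: eqP => [ij|]; last by rewrite !mul0r.
      by move: iN; rewrite ij /= leqNgt ltn_ord.
    by rewrite /p ltnNge iN.
  rewrite (bigD1 (Ordinal iN)) //= big1 => [|j]; last first.
    move=> jn; case: eqP => [ij|]; last by rewrite !mul0r.
    by case/eqP: jn; apply: val_inj; rewrite /= ij.
  have -> : widen_ord leNn (Ordinal iN) = i by exact: val_inj.
  rewrite eqxx mul1r addr0 /p iN eq_sym /s.
  by case: eqP => _; rewrite ?mulr1 ?mulr0 ?addr0 //= addrC subrK.
- have aN : 0 < sigma N.+1 by rewrite sig0.
  move=> i; have si0 : 0 < s i by rewrite sig0 /=.
  rewrite /p; case: ifP => iN; split => //; rewrite ?invr_gt0 //.
    rewrite divff ?gt_eqF // lexx andbT ler_pdivrMr // mul1r.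
    by apply: mono => //=; exact: ltn_ord.
  apply/andP; split.
    by apply: ler_wpM2r; [rewrite invr_ge0 ltW | apply: mono => //=; exact: ltn_ord].
  rewrite ler_pdivrMr // mul1r; apply: mono => //.
  by rewrite /= ltnS leqNgt iN.
Qed.

(** The estimates on the truncated Newton direction.  In the common eigenbasis
    they hold coordinatewise, because eps <= s p <= 1. *)
Lemma lowrank_estimates (R : realType) n N (H : 'M[R]_n) (sigma : nat -> R)
    (U : 'M[R]_(n, N)) (g : 'cV[R]_n) :
  (0 < N < n)%N -> H^T = H -> positive_spectrum H sigma ->
  leading_eigenvectors H sigma U -> g != 0 ->
  let P := Qinv sigma U in
  let d := - (P *m g) in
  let eps := sigma n / sigma N.+1 in
  let lam2 := dot g (invmx H *m g) in
  [/\ 0 < lam2, eps * lam2 <= dot g (P *m g) <= lam2,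
      0 < dot d (H *m d) <= dot g (P *m g) &
      forall w, dot w (g + H *m d) <=
        Num.sqrt (dot w (H *m w)) * ((1 - eps) * Num.sqrt lam2)].
Proof.
move=> hN symH hs hU gn0 P d eps lam2.
have [V [s [p [V1 HE QE sp]]]] := lowrank_eigenbasis hN symH hs hU.
have VV1 : V *m V^T = 1%:M by exact: mulmx1C.
have VK (e : 'I_n -> R) (u : 'cV[R]_n) i :
    (V^T *m (V *m diag_mx (\row_i e i) *m V^T *m u)) i ord0 = e i * (V^T *m u) i ord0.
  by rewrite -!mulmxA !(mulmxA V^T V) V1 mul1mx mul_diag_mx !mxE.
pose b := V^T *m g.
have s0 i : s i != 0 by have [s0 _ _] := sp i; rewrite gt_eqF.
have iHE : invmx H = V *m diag_mx (\row_i (s i)^-1) *m V^T.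
  have HH : H *m (V *m diag_mx (\row_i (s i)^-1) *m V^T) = 1%:M.
    rewrite HE -!mulmxA (mulmxA V^T V) V1 mul1mx (mulmxA (diag_mx _)).
    have -> : diag_mx (\row_i s i) *m diag_mx (\row_i (s i)^-1) = 1%:M.
      apply/matrixP => i j; rewrite mul_diag_mx !mxE.
      by case: eqP => [->|]; rewrite ?divff ?mulr0.
    by rewrite mul1mx.
  have Hu : H \in unitmx by case/mulmx1_unit: HH.
  by rewrite -[LHS]mulmx1 -HH mulKmx.
have lam2E : lam2 = \sum_i (s i)^-1 * b i ord0 ^+ 2.
  by rewrite /lam2 iHE dot_eigenbasis; apply: eq_bigr => i _; rewrite -mulrA.
have del2E : dot g (P *m g) = \sum_i p i * b i ord0 ^+ 2.
  by rewrite /P QE dot_eigenbasis; apply: eq_bigr => i _; rewrite -mulrA.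
have PgE i : (V^T *m (P *m g)) i ord0 = p i * b i ord0 by rewrite /P QE VK.
have dHd : dot d (H *m d) = \sum_i s i * p i ^+ 2 * b i ord0 ^+ 2.
  rewrite /d mulmxN dotNl dotNr opprK HE dot_eigenbasis.
  by apply: eq_bigr => i _; rewrite PgE; ring.
have bn0 : exists i, b i ord0 != 0.
  apply/existsP; apply: contraNT gn0; rewrite negb_exists => /forallP b0.
  rewrite -[g]mul1mx -VV1 -mulmxA -/b.
  suff -> : b = 0 by rewrite mulmx0.
  by apply/colP => i; have := b0 i; rewrite negbK => /eqP ->; rewrite mxE.
have sum_gt0 (c : 'I_n -> R) : (forall i, 0 < c i) -> 0 < \sum_i c i * b i ord0 ^+ 2.
  move=> c0; have [j bj] := bn0; rewrite (bigD1 j) //=; apply: ltr_wpDr.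
    by apply: sumr_ge0 => i _; rewrite mulr_ge0 ?sqr_ge0 // ltW.
  by rewrite mulr_gt0 // exprn_even_gt0.
have sum_le (c c' : 'I_n -> R) : (forall i, c i <= c' i) ->
    \sum_i c i * b i ord0 ^+ 2 <= \sum_i c' i * b i ord0 ^+ 2.
  by move=> cc; apply: ler_sum => i _; rewrite ler_wpM2r // sqr_ge0.
split.
- by rewrite lam2E; apply: sum_gt0 => i; have [? _ _] := sp i; rewrite invr_gt0.
- rewrite del2E lam2E mulr_sumr; under eq_bigr => i _ do rewrite mulrA.
  rewrite !sum_le // => i; have [si pi /andP[spl spu]] := sp i.
    by rewrite -[(s i)^-1]mul1r ler_pdivlMr // mulrC.
  by rewrite ler_pdivrMr // mulrC.
- rewrite dHd del2E sum_gt0 => [|i]; last first.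
    by have [si pi _] := sp i; rewrite mulr_gt0 // exprn_gt0.
  rewrite sum_le // => i; have [si pi /andP[spl spu]] := sp i.
  by rewrite expr2 mulrA ler_piMl // ltW.
- move=> w; pose c := V^T *m w.
  have -> : dot w (H *m w) = \sum_i s i * c i ord0 ^+ 2.
    by rewrite HE dot_eigenbasis; apply: eq_bigr => i _; rewrite -mulrA.
  have -> : dot w (g + H *m d) =
      \sum_i (Num.sqrt (s i) * c i ord0) * (Num.sqrt ((s i)^-1) * ((1 - s i * p i) * b i ord0)).
    rewrite dotDr /d mulmxN dotNr {1}HE dot_eigenbasis.
    rewrite -[in dot w g](mul1mx g) -VV1 -mulmxA.
    have -> : V *m (V^T *m g) = V *m diag_mx (\row_i 1) *m V^T *m g.
      have -> : diag_mx (\row_(i < n) 1) = 1%:M :> 'M[R]_n.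
        by apply/matrixP => i j; rewrite !mxE.
      by rewrite mulmx1 mulmxA.
    rewrite dot_eigenbasis -sumrB; apply: eq_bigr => i _.
    rewrite PgE -/b -/c; have [si _ _] := sp i.
    have sq1 : Num.sqrt (s i) * Num.sqrt ((s i)^-1) = 1.
      by rewrite -sqrtrM ?ltW // divff // sqrtr1.
    by rewrite [RHS]mulrACA sq1; ring.
  have S0 (e : 'I_n -> R) : 0 <= \sum_i e i ^+ 2.
    by apply: sumr_ge0 => i _; exact: sqr_ge0.
  have sq (e : 'I_n -> R) (x : 'I_n -> R) : (forall i, 0 <= e i) ->
      \sum_i e i * x i ^+ 2 = \sum_i (Num.sqrt (e i) * x i) ^+ 2.
    by move=> e0; apply: eq_bigr => i _; rewrite exprMn sqr_sqrtr.
  have sw i : 0 <= s i by have [/ltW] := sp i.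
  apply: le_trans (ler_norm _) _.
  have eps1 : 0 <= 1 - eps.
    have [i _] := bn0; have [_ _ /andP[h1 h2]] := sp i.
    by rewrite subr_ge0 (le_trans h1).
  rewrite -[`|_|]sqrtr_sqr; apply: (@le_trans _ _ (Num.sqrt
     ((\sum_i s i * c i ord0 ^+ 2) * ((1 - eps) ^+ 2 * lam2)))); last first.
    rewrite sqrtrM; last by rewrite sq.
    by rewrite sqrtrM ?sqr_ge0 // sqrtr_sqr ger0_norm.
  apply: ler_wsqrtr; apply: le_trans (sum_cauchy_schwarz _ _) _.
  rewrite sq //; apply: ler_wpM2l => //.
  rewrite -sq => [|i]; last by rewrite invr_ge0.
  rewrite lam2E mulr_sumr; apply: ler_sum => i _.
  have [si pi /andP[spl spu]] := sp i.
  rewrite exprMn mulrCA; apply: ler_wpM2r; last first.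
    by apply: lerXn2r; rewrite ?nnegrE // ?subr_ge0 // lerB.
  by rewrite mulr_ge0 ?sqr_ge0 // invr_ge0.
Qed.

(** * Derivatives on segments *)

Lemma mvt_closed (R : realType) (f df : R -> R) (a b : R) :
  a <= b -> (forall t, a <= t <= b -> is_derive t 1 f (df t)) ->
  exists2 c, a <= c <= b & f b - f a = df c * (b - a).
Proof.
move=> ab fd.
have [t||c + E] := @MVT_segment R f df a b ab; last by rewrite in_itv /=; exists c.
- by rewrite in_itv /= => /andP[a_t tb]; apply: fd; rewrite !ltW.
- apply: derivable_within_continuous => t; rewrite in_itv /= => /fd.
  by case.
Qed.

Lemma ge0_derive_le (R : realType) (f df : R -> R) (a b : R) :
  a <= b -> (forall t, a <= t <= b -> is_derive t 1 f (df t)) ->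
  (forall t, a <= t <= b -> 0 <= df t) -> f a <= f b.
Proof.
move=> ab fd f0; have [c cab E] := mvt_closed ab fd.
by rewrite -subr_ge0 E mulr_ge0 ?f0 // subr_ge0.
Qed.

Lemma ge0_second_derive (R : realType) (f df ddf : R -> R) (a b : R) :
  a <= b -> (forall t, a <= t <= b -> is_derive t 1 f (df t)) ->
  (forall t, a <= t <= b -> is_derive t 1 df (ddf t)) ->
  (forall t, a <= t <= b -> 0 <= ddf t) -> 0 <= df a -> f a <= f b.
Proof.
move=> ab fd dfd ddf0 dfa; apply: (ge0_derive_le ab fd) => t /andP[a_t tb].
apply: le_trans dfa _; apply: (ge0_derive_le a_t (df := ddf)) => u /andP[au ut].
  by apply: dfd; rewrite au (le_trans ut).
by apply: ddf0; rewrite au (le_trans ut).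
Qed.

(** * Partial derivatives and restrictions to lines *)

Lemma derive_partials (R : realType) n (F : 'cV[R]_n -> R) (p d : 'cV[R]_n) :
  differentiable F p -> 'D_d F p = \sum_k d k ord0 * partial k F p.
Proof.
move=> dF; rewrite deriveE // {1}[d]matrix_sum_delta.
rewrite linear_sum; apply: eq_bigr => k _.
by rewrite big_ord1 linearZ /= /partial deriveE.
Qed.

Lemma is_derive_line (R : realType) n (F : 'cV[R]_n -> R) (x d : 'cV[R]_n)
    (t : R) :
  differentiable F (x + t *: d) ->
  is_derive t 1 (fun t => F (x + t *: d))
    (\sum_k d k ord0 * partial k F (x + t *: d)).
Proof.
move=> dF; rewrite -derive_partials //.
have E : (fun h : R => h^-1 *: (((fun t => F (x + t *: d)) \o shift t) (h *: (1 : R)) -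
      F (x + t *: d))) =
   (fun h : R => h^-1 *: ((F \o shift (x + t *: d)) (h *: d) - F (x + t *: d))).
  apply/funext => h /=; congr (_ *: (F _ - _)).
  by rewrite [h *: 1]mulr1 scalerDl addrCA.
split; last by rewrite /derive E.
by rewrite /derivable E; exact: diff_derivable.
Qed.

Lemma cont_diff_lower (R : realType) n m A (F : 'cV[R]_n -> R) :
  cont_diff m.+1 A F -> cont_diff m A F.
Proof.
elim: m F => [|m IH] F /= [dF pF].
  by apply: continuous_in_subspaceT => y /set_mem /dF /differentiable_continuous.
by split => // i; apply: IH; exact: pF.
Qed.

(** The mean value theorem in direction i, then in direction j. *)
Lemma mixed_difference (R : realType) n (F : 'cV[R]_n -> R) (x : 'cV[R]_n)
    (i j : 'I_n) (s : R) (A : set 'cV[R]_n) (p : R -> R -> 'cV[R]_n) :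
  (forall a b, p a b = x + a *: delta_mx i ord0 + b *: delta_mx j ord0) ->
  0 < s ->
  (forall y, A y -> differentiable F y) ->
  (forall y, A y -> differentiable (partial i F) y) ->
  (forall a b, 0 <= a <= s -> 0 <= b <= s -> A (p a b)) ->
  exists a b, [/\ 0 <= a <= s, 0 <= b <= s &
    F (p s s) - F (p s 0) - F (p 0 s) + F (p 0 0) =
    s ^+ 2 * partial j (partial i F) (p a b)].
Proof.
move=> pE s0 dF dFi inA.
have sum_delta (G : 'cV[R]_n -> R) k y :
    \sum_l (delta_mx k ord0 : 'cV[R]_n) l ord0 * partial l G y = partial k G y.
  rewrite (bigD1 k) //= big1 ?addr0 => [|l lk]; rewrite mxE ?eqxx ?mul1r //.
  by rewrite (negbTE lk) mul0r.
have pC a b : p a b = x + b *: delta_mx j ord0 + a *: delta_mx i ord0.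
  by rewrite pE addrAC.
have d1 a b : 0 <= a <= s -> 0 <= b <= s ->
    is_derive a 1 (fun a => F (p a b)) (partial i F (p a b)).
  move=> ha hb; rewrite -(sum_delta F i) pC.
  under eq_fun do rewrite pC.
  by apply: is_derive_line; rewrite -pC; apply/dF/inA.
have d2 a b : 0 <= a <= s -> 0 <= b <= s ->
    is_derive b 1 (fun b => partial i F (p a b)) (partial j (partial i F) (p a b)).
  move=> ha hb; rewrite -(sum_delta (partial i F) j) pE.
  under eq_fun do rewrite pE.
  by apply: is_derive_line; rewrite -pE; apply/dFi/inA.
have zs : (0 : R) <= 0 <= s by lra.
have ss : 0 <= s <= s by lra.
have [a as_ Ea] : exists2 a, 0 <= a <= s & (F (p s s) - F (p s 0)) - (F (p 0 s) - F (p 0 0)) =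
    (partial i F (p a s) - partial i F (p a 0)) * (s - 0).
  apply: (mvt_closed (f := fun a => F (p a s) - F (p a 0)) (ltW s0)) => a ha.
  by apply: is_deriveB; apply: d1.
have [b bs_ Eb] : exists2 b, 0 <= b <= s & partial i F (p a s) - partial i F (p a 0) =
    partial j (partial i F) (p a b) * (s - 0).
  by apply: (mvt_closed (f := fun b => partial i F (p a b)) (ltW s0)) => b hb; exact: d2.
exists a, b; split => //; rewrite expr2 -mulrA [s * partial _ _ _]mulrC.
by rewrite subr0 in Ea Eb; rewrite -Eb mulrC -Ea; ring.
Qed.

(** Schwarz: both iterated partial derivatives are limits of the same second
    difference quotient of F over a shrinking square. *)
Lemma partialC (R : realType) n (A : set 'cV[R]_n) (F : 'cV[R]_n -> R) i j x :
  open A -> cont_diff 2 A F -> A x ->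
  partial i (partial j F) x = partial j (partial i F) x.
Proof.
move=> oA [dF cF] Ax.
have cont k l : {for x, continuous (partial k (partial l F))}.
  have [_ /(_ k)] := cF l.
  by rewrite continuous_open_subspace // => /(_ x); apply; exact/mem_set.
apply/eqP; rewrite -subr_eq0 -normr_le0; apply/ler_addgt0Pl => e e0; rewrite addr0.
have e20 : 0 < e / 2 by rewrite divr_gt0.
have close (a b c : R) : `|a - c| < e / 2 -> `|b - c| < e / 2 -> `|a - b| <= e.
  move=> ac bc; have -> : a - b = (a - c) - (b - c) by ring.
  by apply: le_trans (ler_normB _ _) _; lra.
have nA : nbhs x A by exact: open_nbhs_nbhs.
have n1 : nbhs x [set y | `|partial j (partial i F) x - partial j (partial i F) y| < e / 2].
  have /cvgrPdist_lt/(_ _ e20) := cont j i; exact.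
have n2 : nbhs x [set y | `|partial i (partial j F) x - partial i (partial j F) y| < e / 2].
  have /cvgrPdist_lt/(_ _ e20) := cont i j; exact.
have [r /= r0 rA] : nbhs_ball x (A `&` ([set y |
      `|partial j (partial i F) x - partial j (partial i F) y| < e / 2] `&`
    [set y | `|partial i (partial j F) x - partial i (partial j F) y| < e / 2])).
  apply/nbhs_ballP; apply: filterI; first exact: nA.
  by apply: filterI; [exact: n1 | exact: n2].
pose M := `|delta_mx i ord0 : 'cV[R]_n| + `|delta_mx j ord0 : 'cV[R]_n| + 1.
have M0 : 0 < M by rewrite /M; apply: ltr_wpDl => //; rewrite addr_ge0.
pose s := r / (2 * M).
have s0 : 0 < s by rewrite divr_gt0 // mulr_gt0.
have near_x a b : 0 <= a <= s -> 0 <= b <= s ->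
    ball x r (x + a *: delta_mx i ord0 + b *: delta_mx j ord0).
  move=> /andP[a0 a1] /andP[b0 b1]; rewrite -ball_normE /ball_ /=.
  rewrite -addrA opprD addrA subrr add0r normrN.
  apply: le_lt_trans (ler_normD _ _) _; rewrite !normrZ !ger0_norm //.
  apply: (@le_lt_trans _ _ (s * M)).
    rewrite /M !mulrDr mulr1; apply: ler_wpDr; first exact: ltW.
    by apply: lerD; apply: ler_wpM2r.
  rewrite /s invfM mulrA mulfVK ?gt_eqF //; lra.
pose p (a b : R) := x + a *: delta_mx i ord0 + b *: delta_mx j ord0.
pose q (a b : R) := x + a *: delta_mx j ord0 + b *: delta_mx i ord0.
have pE a b : p a b = x + a *: delta_mx i ord0 + b *: delta_mx j ord0 by [].
have qE a b : q a b = x + a *: delta_mx j ord0 + b *: delta_mx i ord0 by [].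
clearbody p q s.
have qp a b : q a b = p b a by rewrite qE pE addrAC.
have in_p a b : 0 <= a <= s -> 0 <= b <= s -> ball x r (p a b).
  by rewrite pE; exact: near_x.
have in_q a b : 0 <= a <= s -> 0 <= b <= s -> ball x r (q a b).
  by rewrite qp => ha hb; exact: in_p.
have [|||a [b [ha hb E1]]] := @mixed_difference R n F x i j s A p pE s0.
- exact: dF.
- by move=> y; have [+ _] := cF i; apply.
- by move=> a b ha hb; have [] := rA _ (in_p a b ha hb).
have [|||c [d [hc hd E2]]] := @mixed_difference R n F x j i s A q qE s0.
- exact: dF.
- by move=> y; have [+ _] := cF j; apply.
- by move=> a' b' ha' hb'; have [] := rA _ (in_q a' b' ha' hb').
have E : partial i (partial j F) (q c d) = partial j (partial i F) (p a b).
  apply: (@mulfI _ (s ^+ 2)); first by rewrite expf_neq0 // gt_eqF.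
  rewrite -[RHS]E1 -[LHS]E2 !qp.
  by ring.
have [_ [_ b1]] := rA _ (in_q c d hc hd).
have [_ [b2 _]] := rA _ (in_p a b ha hb).
move: b1 b2; rewrite /= E => b1 b2; exact: close b1 b2.
Qed.

(** * Gradient, Hessian and third derivative along a line *)

Definition third_form (R : realType) n (f : 'cV[R]_n -> R) (y u v w : 'cV[R]_n) : R :=
  \sum_i \sum_j \sum_k u i ord0 * v j ord0 * w k ord0 *
    partial i (partial j (partial k f)) y.

Lemma dot_hessian (R : realType) n (f : 'cV[R]_n -> R) (y u v : 'cV[R]_n) :
  dot u (hessian f y *m v) =
  \sum_i \sum_j u i ord0 * v j ord0 * partial i (partial j f) y.
Proof.
rewrite dotE; apply: eq_bigr => i _; rewrite mxE mulr_sumr.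
by apply: eq_bigr => j _; rewrite mxE; ring.
Qed.

Lemma hessian_sym (R : realType) n (A : set 'cV[R]_n) (f : 'cV[R]_n -> R) y :
  open A -> cont_diff 3 A f -> A y -> (hessian f y)^T = hessian f y.
Proof.
move=> oA cf Ay; apply/matrixP => i j; rewrite !mxE.
by apply: (partialC j i oA _ Ay); exact: cont_diff_lower.
Qed.

Lemma line_derive1 (R : realType) n (A : set 'cV[R]_n) (f : 'cV[R]_n -> R) x d (t : R) :
  cont_diff 3 A f -> A (x + t *: d) ->
  is_derive t 1 (fun t => f (x + t *: d)) (dot d (gradient f (x + t *: d))).
Proof.
move=> [df _] At; rewrite dotE; under eq_bigr => i _ do rewrite mxE.
by apply: is_derive_line; exact: df.
Qed.

Lemma line_derive2 (R : realType) n (A : set 'cV[R]_n) (f : 'cV[R]_n -> R) x d w (t : R) :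
  cont_diff 3 A f -> A (x + t *: d) ->
  is_derive t 1 (fun t => dot w (gradient f (x + t *: d)))
    (dot d (hessian f (x + t *: d) *m w)).
Proof.
move=> [_ cf] At.
have -> : (fun t => dot w (gradient f (x + t *: d))) =
    \sum_i (w i ord0 *: (fun t => partial i f (x + t *: d))).
  by apply/funext => s; rewrite dotE fct_sumE; apply: eq_bigr => i _; rewrite mxE.
have -> : dot d (hessian f (x + t *: d) *m w) =
    \sum_j w j ord0 *: (\sum_i d i ord0 * partial i (partial j f) (x + t *: d)).
  rewrite dot_hessian exchange_big /=; apply: eq_bigr => j _.
  by rewrite scaler_sumr; apply: eq_bigr => i _; rewrite /GRing.scale /=; ring.
apply: is_derive_sum => i; apply: is_deriveZ.
by apply: is_derive_line; have [+ _] := cf i; apply.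
Qed.

Lemma line_derive3 (R : realType) n (A : set 'cV[R]_n) (f : 'cV[R]_n -> R) x d u v (t : R) :
  cont_diff 3 A f -> A (x + t *: d) ->
  is_derive t 1 (fun t => dot u (hessian f (x + t *: d) *m v))
    (third_form f (x + t *: d) d u v).
Proof.
move=> [_ cf] At.
have -> : (fun t => dot u (hessian f (x + t *: d) *m v)) =
    \sum_i \sum_j ((u i ord0 * v j ord0) *: (fun t => partial i (partial j f) (x + t *: d))).
  apply/funext => s; rewrite dot_hessian fct_sumE; apply: eq_bigr => i _.
  by rewrite fct_sumE.
have -> : third_form f (x + t *: d) d u v =
    \sum_i \sum_j (u i ord0 * v j ord0) *:
      (\sum_k d k ord0 * partial k (partial i (partial j f)) (x + t *: d)).
  rewrite /third_form exchange_big /=; apply: eq_bigr => i _.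
  rewrite exchange_big /=; apply: eq_bigr => j _.
  by rewrite scaler_sumr; apply: eq_bigr => k _; rewrite /GRing.scale /=; ring.
apply: is_derive_sum => i; apply: is_derive_sum => j; apply: is_deriveZ.
apply: is_derive_line; have [_ /(_ i)[+ _]] := cf j; exact.
Qed.

Lemma third_formDl (R : realType) n (f : 'cV[R]_n -> R) y u u' v w a b :
  third_form f y (a *: u + b *: u') v w =
  a * third_form f y u v w + b * third_form f y u' v w.
Proof.
rewrite /third_form !mulr_sumr -big_split; apply: eq_bigr => i _ /=.
rewrite !mulr_sumr -big_split; apply: eq_bigr => j _ /=.
rewrite !mulr_sumr -big_split; apply: eq_bigr => k _ /=.
by rewrite !mxE; ring.
Qed.

Lemma third_formC12 (R : realType) n (A : set 'cV[R]_n) (f : 'cV[R]_n -> R) y u v w :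
  open A -> cont_diff 3 A f -> A y -> third_form f y u v w = third_form f y v u w.
Proof.
move=> oA [_ cf] Ay; rewrite /third_form exchange_big /=; apply: eq_bigr => j _.
apply: eq_bigr => i _; apply: eq_bigr => k _.
by rewrite (partialC i j oA (cf k) Ay); ring.
Qed.

Lemma third_formC23 (R : realType) n (A : set 'cV[R]_n) (f : 'cV[R]_n -> R) y u v w :
  open A -> cont_diff 3 A f -> A y -> third_form f y u v w = third_form f y u w v.
Proof.
move=> oA cf Ay; rewrite /third_form; apply: eq_bigr => i _; rewrite exchange_big /=.
apply: eq_bigr => k _; apply: eq_bigr => j _.
rewrite [u i ord0 * v j ord0 * w k ord0]mulrAC; apply: (congr1 (fun z => _ * z)).
apply: near_eq_derive; near=> z; apply: (partialC j k oA).
  exact: cont_diff_lower.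
by near: z; exact: open_nbhs_nbhs.
Unshelve. all: by end_near. Qed.

Lemma near_line (R : realType) n (A : set 'cV[R]_n) x d (t : R) :
  open A -> A (x + t *: d) -> \forall s \near t, A (x + s *: d).
Proof.
move=> oA At.
have ct : {for t, continuous (fun s : R => x + s *: d)}.
  by apply: continuousD; [exact: cst_continuous | exact: scalel_continuous].
by apply: ct; exact: open_nbhs_nbhs.
Qed.

Lemma line_derive1n (R : realType) n (A : set 'cV[R]_n) (f : 'cV[R]_n -> R) x d (t : R) :
  open A -> cont_diff 3 A f -> A (x + t *: d) ->
  derive1n 2 (fun t => f (x + t *: d)) t = dot d (hessian f (x + t *: d) *m d) /\
  derive1n 3 (fun t => f (x + t *: d)) t = third_form f (x + t *: d) d d d.
Proof.
move=> oA cf At; set phi := fun t => _.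
have near_derive1 (g h : R -> R) (s : R) :
    (\forall r \near s, g r = h r) -> derive1 g s = derive1 h s.
  by move=> gh; rewrite !derive1E; exact: near_eq_derive.
have E1 s : A (x + s *: d) -> derive1 phi s = dot d (gradient f (x + s *: d)).
  by move=> As; rewrite derive1E; have [_ ->] := line_derive1 cf As.
have E2 s : A (x + s *: d) -> derive1n 2 phi s = dot d (hessian f (x + s *: d) *m d).
  move=> As; have [_ <-] := line_derive2 d cf As; rewrite -derive1E.
  apply: near_derive1; near=> r; apply: E1; near: r; exact: near_line.
split; first exact: E2.
have [_ <-] := line_derive3 d d cf At; rewrite -derive1E.
apply: near_derive1; near=> r; apply: E2; near: r; exact: near_line.
Unshelve. all: by end_near. Qed.

(** * Local norms of a self-concordant function *)

Lemma psd_cauchy_schwarz (R : realFieldType) (E F G : R) :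
  (forall s t, 0 <= E * s ^+ 2 + 2 * F * s * t + G * t ^+ 2) ->
  [/\ 0 <= E, 0 <= G & F ^+ 2 <= E * G].
Proof.
move=> q0; have E0 := q0 1 0; have G0 := q0 0 1.
have Gp : 0 <= G by lra.
split => //; first by lra.
have [G_eq0|Gn0] := eqVneq G 0.
  (* Along s = F this value of t turns the form into - F^2. *)
  have := q0 F (- (E + 1) / 2); rewrite G_eq0; nra.
have Gpos : 0 < G by rewrite lt0r Gn0.
by rewrite -subr_ge0 -(pmulr_rge0 _ Gpos); have := q0 G (- F); nra.
Qed.

Lemma concave_midpoint_le (R : realType) (f df ddf : R -> R) (h : R) : 0 < h ->
  (forall t, - h <= t <= h -> is_derive t 1 f (df t)) ->
  (forall t, - h <= t <= h -> is_derive t 1 df (ddf t)) ->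
  (forall t, - h <= t <= h -> ddf t < 0) -> f h + f (- h) <= 2 * f 0.
Proof.
move=> h0 fd dfd neg; have h0' : - h <= 0 by lra.
have [c1 hc1 E1] : exists2 c, 0 <= c <= h & f h - f 0 = df c * (h - 0).
  by apply: (mvt_closed (ltW h0)) => t ht; apply: fd; lra.
have [c2 hc2 E2] : exists2 c, - h <= c <= 0 & f 0 - f (- h) = df c * (0 - - h).
  by apply: (mvt_closed h0') => t ht; apply: fd; lra.
have c21 : c2 <= c1 by lra.
have [c3 hc3 E3] : exists2 c, c2 <= c <= c1 & df c1 - df c2 = ddf c * (c1 - c2).
  by apply: (mvt_closed c21) => t ht; apply: dfd; lra.
have q3 : ddf c3 < 0 by apply: neg; lra.
have d12 : df c1 - df c2 <= 0 by rewrite E3; nra.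
nra.
Qed.

(** Where a second derivative is negative the function is strictly concave,
    against convexity. *)
Lemma hessian_psd (R : realType) n (dom : set 'cV[R]_n) (f : 'cV[R]_n -> R) y d :
  sc_function dom f -> dom y -> 0 <= dot d (hessian f y *m d).
Proof.
case=> oA _ cf cvx _ _ _ Ay; rewrite leNgt; apply/negP => neg.
have dn0 : d != 0.
  by apply: contraTneq neg => ->; rewrite mulmx0 dotE big1 ?ltxx // => i _; rewrite mxE mul0r.
have y0 : y + 0 *: d = y by rewrite scale0r addr0.
pose q (t : R) := dot d (hessian f (y + t *: d) *m d).
have cq : {for 0, continuous q}.
  apply: differentiable_continuous; apply/derivable1_diffP.
  have A0 : dom (y + 0 *: d) by rewrite y0.
  by have [] := line_derive3 d d cf A0.
have q0 : q 0 < 0 by rewrite /q y0.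
have nq : \forall t \near (0 : R), q t < 0.
  exact: (cvgr_lt _ cq _ q0).
have nA : \forall t \near (0 : R), dom (y + t *: d).
  by apply: near_line => //; rewrite y0.
have [e /= e0 he] : nbhs_ball (0 : R) ([set t | q t < 0] `&` [set t | dom (y + t *: d)]).
  by apply/nbhs_ballP; apply: filterI; [exact: nq | exact: nA].
pose h := e / 2.
have h0 : 0 < h by rewrite divr_gt0.
have inb t : - h <= t <= h -> q t < 0 /\ dom (y + t *: d).
  move=> /andP[t1 t2]; have [] // := he t; rewrite -ball_normE /ball_ /= sub0r normrN.
  rewrite ltr_norml; apply/andP; rewrite /h in t1 t2; lra.
have hh : - h <= h <= h by rewrite lexx andbT; lra.
have mhh : - h <= - h <= h by rewrite lexx; lra.
have hne : y + h *: d != y + (- h) *: d.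
  apply/eqP => /addrI /eqP; rewrite -subr_eq0 -scalerBl scaler_eq0 (negbTE dn0) orbF.
  by rewrite opprK gt_eqF // addr_gt0.
have half : 0 < (1 / 2 : R) < 1 by lra.
have := cvx _ _ _ (inb h hh).2 (inb (- h) mhh).2 hne half.
have -> : (1 / 2) *: (y + h *: d) + (1 - 1 / 2) *: (y + (- h) *: d) = y + 0 *: d.
  rewrite !scalerDr addrACA -scalerDl !scalerA -scalerDl.
  by congr (_ + _ *: _); [rewrite addrC subrK scale1r | field].
apply/negP; rewrite -leNgt.
have := concave_midpoint_le h0 (fun t ht => line_derive1 cf (inb t ht).2)
  (fun t ht => line_derive2 d cf (inb t ht).2) (fun t ht => (inb t ht).1).
move: (f _) (f _) (f _) => a b c; clear; lra.
Qed.

(** The defining inequality bounds the third derivative on the diagonal only;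
    its extension to mixed arguments with the same constant is the bound on
    binary cubic forms, applied on the plane spanned by u and v. *)
Lemma third_form_mixed (R : realType) n (dom : set 'cV[R]_n) (f : 'cV[R]_n -> R) y u v :
  sc_function dom f -> dom y ->
  third_form f y u v v ^+ 2 <=
    4 * dot u (hessian f y *m u) * dot v (hessian f y *m v) ^+ 2.
Proof.
move=> hf Ay; have [oA _ cf _ sc _ _] := hf.
have y0 z : y + (0 : R) *: z = y by rewrite scale0r addr0.
have quad s t : dot (s *: u + t *: v) (hessian f y *m (s *: u + t *: v)) =
    dot u (hessian f y *m u) * s ^+ 2 + 2 * dot u (hessian f y *m v) * s * t +
    dot v (hessian f y *m v) * t ^+ 2.
  have sym : dot v (hessian f y *m u) = dot u (hessian f y *m v).
    by rewrite dotC /dot trmx_mul (hessian_sym oA cf Ay) mulmxA.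
  rewrite mulmxDr -!scalemxAr dotDr !dotZr ![dot (_ + _) _]dotC !dotDr !dotZr.
  by rewrite ![dot (hessian f y *m _) _]dotC sym; ring.
have [E0 G0 FEG] : [/\ 0 <= dot u (hessian f y *m u), 0 <= dot v (hessian f y *m v) &
    dot u (hessian f y *m v) ^+ 2 <= dot u (hessian f y *m u) * dot v (hessian f y *m v)].
  by apply: psd_cauchy_schwarz => s t; rewrite -quad; exact: hessian_psd hf Ay.
apply: (@cubic_form_mixed _ (third_form f y u u u) (third_form f y u u v)
  (third_form f y u v v) (third_form f y v v v) _ (dot u (hessian f y *m v))) => // s t.
rewrite -quad; set z := s *: u + t *: v.
have -> : third_form f y u u u * s ^+ 3 + 3 * third_form f y u u v * s ^+ 2 * t +
    3 * third_form f y u v v * s * t ^+ 2 + third_form f y v v v * t ^+ 3 =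
    third_form f y z z z.
  have C12 a b c := third_formC12 a b c oA cf Ay.
  have C23 a b c := third_formC23 a b c oA cf Ay.
  have Dl b c : third_form f y z b c = s * third_form f y u b c + t * third_form f y v b c.
    exact: third_formDl.
  have Dm a c : third_form f y a z c = s * third_form f y a u c + t * third_form f y a v c.
    by rewrite C12 Dl (C12 u) (C12 v).
  have Dr a b : third_form f y a b z = s * third_form f y a b u + t * third_form f y a b v.
    by rewrite C23 Dm (C23 a u) (C23 a v).
  rewrite Dl !Dm !Dr (C12 v u u) (C23 u v u) (C12 v u v) (C23 v v u) (C12 v u v).
  ring.
have := sc y z Ay 0; rewrite y0 => /(_ Ay).
have A0 : dom (y + 0 *: z) by rewrite y0.
have [-> ->] := line_derive1n oA cf A0; rewrite y0.
have q0 := hessian_psd z hf Ay.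
move=> h; rewrite -[X in X <= _]real_normK ?num_real //.
have -> : 4 * dot z (hessian f y *m z) ^+ 3 =
   (2 * dot z (hessian f y *m z) `^ (3 / 2)) ^+ 2.
  rewrite exprMn -[(_ `^ _) ^+ 2]powR_mulrn ?powR_ge0 // -powRrM.
  rewrite divfK // powR_mulrn //; ring.
by rewrite ler_sqr ?nnegrE // mulr_ge0 // powR_ge0.
Qed.

(** * One-dimensional comparison estimates *)

Lemma is_derive_affine (R : realType) (r t : R) :
  is_derive t 1 (fun t => 1 - t * r) (- r).
Proof.
have D1 : is_derive t 1 (fun _ : R => (1 : R)) 0 by exact: is_derive_cst.
have D2 : is_derive t 1 (fun _ : R => r) 0 by exact: is_derive_cst.
have D3 : is_derive t 1 (fun t : R => t) 1 by exact: is_derive_id.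
apply: (is_derive_eq (is_deriveB D1 (is_deriveM D3 D2))).
by rewrite scaler0 !add0r [r *: 1]mulr1.
Qed.

Lemma is_derive_inv (R : realType) (f : R -> R) (df t : R) :
  is_derive t 1 f df -> f t != 0 ->
  is_derive t 1 (fun t => (f t)^-1) (- (df / f t ^+ 2)).
Proof.
move=> [fd fE] f0; split; first exact: derivableV.
by rewrite deriveV // fE -[_ *: _]/(_ * _) mulNr mulrC.
Qed.

Lemma is_derive_inv_affine (R : realType) (r t : R) : 1 - t * r != 0 ->
  is_derive t 1 (fun t => (1 - t * r)^-1) (r / (1 - t * r) ^+ 2).
Proof.
move=> n0; apply: (is_derive_eq (is_derive_inv (is_derive_affine r t) n0)).
by rewrite mulNr opprK.
Qed.

Lemma is_derive_inv_affine2 (R : realType) (r t : R) : 1 - t * r != 0 ->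
  is_derive t 1 (fun t => r / (1 - t * r) ^+ 2) (2 * r ^+ 2 / (1 - t * r) ^+ 3).
Proof.
move=> n0; have D := is_derive_inv_affine n0.
have DD := is_deriveZ r (is_deriveM D D).
have E : (fun t : R => r / (1 - t * r) ^+ 2) =
   r \*: ((fun t : R => (1 - t * r)^-1) * (fun t : R => (1 - t * r)^-1)).
  by apply/funext => s /=; rewrite expr2 invfM.
rewrite E; apply: (is_derive_eq DD); rewrite /GRing.scale /=; by field.
Qed.

Lemma is_derive_ln_affine (R : realType) (r t : R) : 0 < 1 - t * r ->
  is_derive t 1 (fun t => ln (1 - t * r)) (- (r / (1 - t * r))).
Proof.
move=> n0; have D := @is_derive1_comp _ (@ln R) (fun t => 1 - t * r) t _ _
  (is_derive1_ln n0) (is_derive_affine r t).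
apply: (is_derive_eq D).
by rewrite mulrN mulrC.
Qed.

Lemma is_derive_inv_sqrt (R : realType) (h : R -> R) (dh t : R) :
  is_derive t 1 h dh -> 0 < h t ->
  is_derive t 1 (fun t => (Num.sqrt (h t))^-1)
    (- (dh / (2 * Num.sqrt (h t) ^+ 3))).
Proof.
move=> hd h0; have s0 : Num.sqrt (h t) != 0 by rewrite gt_eqF // sqrtr_gt0.
have dc := @is_derive1_comp _ Num.sqrt h t _ _ (is_derive1_sqrt h0) hd.
apply: (is_derive_eq (is_derive_inv dc s0)); congr (- _).
by rewrite /=; field.
Qed.

(** Self-concordance in one variable: the square root of 1/h is 1-Lipschitz. *)
Lemma inv_sqrt_lipschitz (R : realType) (h dh : R -> R) (a b : R) :
  a <= b -> (forall t, a <= t <= b -> is_derive t 1 h (dh t)) ->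
  (forall t, a <= t <= b -> 0 < h t) ->
  (forall t, a <= t <= b -> dh t ^+ 2 <= 4 * h t ^+ 3) ->
  `|(Num.sqrt (h b))^-1 - (Num.sqrt (h a))^-1| <= b - a.
Proof.
move=> ab hd h0 bound.
have [c cab ->] := mvt_closed ab (fun t ht => is_derive_inv_sqrt (hd t ht) (h0 t ht)).
rewrite normrM [`|b - a|]ger0_norm ?subr_ge0 // ler_piMl ?subr_ge0 //.
have hc := h0 c cab; have sc : 0 < Num.sqrt (h c) by rewrite sqrtr_gt0.
rewrite normrN normrM normfV [`|2 * _|]gtr0_norm ?mulr_gt0 ?exprn_gt0 //.
rewrite ler_pdivrMr ?mulr_gt0 ?exprn_gt0 // mul1r.
rewrite -ler_sqr ?nnegrE ?mulr_ge0 ?exprn_ge0 ?sqrtr_ge0 // real_normK ?num_real //.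
have -> : (2 * Num.sqrt (h c) ^+ 3) ^+ 2 = 4 * (Num.sqrt (h c) ^+ 2) ^+ 3 by ring.
by rewrite sqr_sqrtr ?(ltW hc) //; exact: bound.
Qed.

(** A zero of h would contradict the Lipschitz bound, which is first applied
    to h + e where no zero can occur. *)
Lemma sc_positive (R : realType) (h dh : R -> R) (T : R) :
  0 <= T -> (forall t, 0 <= t <= T -> is_derive t 1 h (dh t)) ->
  (forall t, 0 <= t <= T -> 0 <= h t) ->
  (forall t, 0 <= t <= T -> dh t ^+ 2 <= 4 * h t ^+ 3) ->
  0 < h T -> forall t, 0 <= t <= T -> 0 < h t.
Proof.
move=> T0 hd h0 bound hT t /andP[t0 tT].
pose c := ((Num.sqrt (h T))^-1 + T)^-1.
have sT : 0 < Num.sqrt (h T) by rewrite sqrtr_gt0.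
have c0 : 0 < c by rewrite invr_gt0 ltr_wpDr // invr_gt0.
suff ch : c ^+ 2 <= h t by apply: lt_le_trans ch; rewrite exprn_gt0.
apply/ler_addgt0Pr => e e0.
have htT s : t <= s <= T -> 0 <= s <= T by move=> /andP[ts sT']; rewrite (le_trans t0 ts).
have hp s : t <= s <= T -> 0 < h s + e.
  by move=> /htT/h0 hs; rewrite ltr_wpDl.
have lip : `|(Num.sqrt (h T + e))^-1 - (Num.sqrt (h t + e))^-1| <= T - t.
  apply: (@inv_sqrt_lipschitz R (fun s => h s + e) dh t T tT _ hp) => s /htT hs; last first.
    apply: le_trans (bound s hs) _; rewrite ler_pM2l //.
    by apply: lerXn2r; rewrite ?nnegrE ?addr_ge0 ?h0 ?(ltW e0) // lerDl ltW.
  have D := hd s hs; have De : is_derive s 1 (fun _ : R => e) 0 by exact: is_derive_cst.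
  by apply: (is_derive_eq (is_deriveD D De)); rewrite addr0.
have het : 0 < h t + e by apply: hp; rewrite lexx.
have st : 0 < Num.sqrt (h t + e) by rewrite sqrtr_gt0.
move: lip; rewrite distrC => /ler_normlW; rewrite lerBlDr => le1.
have le2 : (Num.sqrt (h T + e))^-1 <= (Num.sqrt (h T))^-1.
  by rewrite lef_pV2 ?posrE ?sqrtr_gt0 ?ltr_wpDr ?(ltW e0) // ler_wsqrtr // lerDl ltW.
have le3 : (Num.sqrt (h t + e))^-1 <= (Num.sqrt (h T))^-1 + T.
  by apply: le_trans le1 _; rewrite addrC; apply: lerD => //; rewrite lerBlDr lerDl.
rewrite -[h t + e]sqr_sqrtr ?(ltW het) //.
apply: lerXn2r; rewrite ?nnegrE ?(ltW c0) ?sqrtr_ge0 //.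
by rewrite -[leRHS]invrK lef_pV2 ?posrE ?invr_gt0 // ltr_wpDr ?invr_gt0.
Qed.

(** Integrating the Lipschitz bound: the solution of h' = 2 h^(3/2) starting at
    r^2 is (r / (1 - t r))^2. *)
Lemma sc_growth (R : realType) (h dh : R -> R) (T r : R) :
  0 <= T -> (forall t, 0 <= t <= T -> is_derive t 1 h (dh t)) ->
  (forall t, 0 <= t <= T -> 0 <= h t) ->
  (forall t, 0 <= t <= T -> dh t ^+ 2 <= 4 * h t ^+ 3) ->
  0 < r -> h 0 <= r ^+ 2 -> T * r < 1 -> h T <= (r / (1 - T * r)) ^+ 2.
Proof.
move=> T0 hd h0 bound r0 hr Tr.
have Tr0 : 0 < 1 - T * r by rewrite subr_gt0.
have [hT|hT] := leP (h T) 0; first by apply: le_trans hT _; exact: sqr_ge0.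
have hp := sc_positive T0 hd h0 bound hT.
have := inv_sqrt_lipschitz T0 hd hp bound; rewrite distrC subr0 => /ler_normlW.
have h00 : 0 < h 0 by apply: hp; rewrite lexx.
have sT : 0 < Num.sqrt (h T) by rewrite sqrtr_gt0.
have s0 : 0 < Num.sqrt (h 0) by rewrite sqrtr_gt0.
have sr : Num.sqrt (h 0) <= r.
  by rewrite -[leRHS]ger0_norm ?(ltW r0) // -sqrtr_sqr ler_wsqrtr.
have ir : r^-1 <= (Num.sqrt (h 0))^-1 by rewrite lef_pV2 ?posrE.
move=> lip.
have le1 : (1 - T * r) / r <= (Num.sqrt (h T))^-1.
  rewrite mulrBl mul1r mulfK ?gt_eqF //; move: lip ir; lra.
rewrite -[leLHS]sqr_sqrtr ?(ltW hT) //.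
apply: lerXn2r; rewrite ?nnegrE ?sqrtr_ge0 ?divr_ge0 ?(ltW r0) ?(ltW Tr0) //.
by rewrite -[leLHS]invrK -[leRHS]invrK invf_div lef_pV2 ?posrE ?invr_gt0 ?divr_gt0.
Qed.

(** Gronwall: p (1 - t r)^2 is nonincreasing and p / (1 - t r)^2 is
    nondecreasing. *)
Lemma sc_metric_bounds (R : realType) (p dp : R -> R) (T r : R) :
  0 <= T -> (forall t, 0 <= t <= T -> is_derive t 1 p (dp t)) ->
  (forall t, 0 <= t <= T -> 0 <= p t) -> 0 < r -> T * r < 1 ->
  (forall t, 0 <= t <= T -> dp t ^+ 2 <= 4 * (r / (1 - t * r)) ^+ 2 * p t ^+ 2) ->
  (1 - T * r) ^+ 2 * p 0 <= p T /\ p T <= p 0 / (1 - T * r) ^+ 2.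
Proof.
move=> T0 pd p0 r0 Tr bound.
have a0 (t : R) : 0 <= t <= T -> 0 < 1 - t * r.
  by move=> /andP[_ tT]; rewrite subr_gt0 (le_lt_trans _ Tr) // ler_wpM2r // ltW.
have dpb (t : R) : 0 <= t <= T -> `|dp t| <= 2 * (r / (1 - t * r)) * p t.
  move=> ht; have rt : 0 < r / (1 - t * r) by rewrite divr_gt0 // a0.
  have nn : 0 <= 2 * (r / (1 - t * r)) * p t.
    by apply: mulr_ge0; [apply: mulr_ge0 => //; exact: ltW | exact: p0].
  rewrite -ler_sqr ?nnegrE // real_normK ?num_real //.
  by apply: le_trans (bound t ht) _; rewrite le_eqVlt; apply/orP; left; apply/eqP; ring.
have TT : 0 <= T <= T by rewrite T0 lexx.
have zT : (0 : R) <= 0 <= T by rewrite lexx.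
split.
- have D (t : R) : 0 <= t <= T -> is_derive t 1 (fun t => p t / (1 - t * r) ^+ 2)
      ((dp t + 2 * (r / (1 - t * r)) * p t) / (1 - t * r) ^+ 2).
    move=> ht; have n0 : 1 - t * r != 0 by rewrite gt_eqF // a0.
    have D2 := is_derive_inv_affine2 n0.
    have DD := is_deriveM (pd t ht) (is_deriveZ r^-1 D2).
    have E : (fun t : R => p t / (1 - t * r) ^+ 2) =
        p * (r^-1 \*: (fun t : R => r / (1 - t * r) ^+ 2)).
      apply/funext => s /=; rewrite -[RHS]/(p s * (r^-1 * (r / (1 - s * r) ^+ 2))).
      by rewrite mulKf // gt_eqF.
    rewrite E; apply: (is_derive_eq DD); rewrite /GRing.scale /=.
    by rewrite -[r^-1 *: _]/(_ * _); field; rewrite n0 gt_eqF.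
  have := ge0_derive_le T0 D; rewrite mul0r subr0 expr1n divr1 => le1.
  rewrite mulrC -ler_pdivlMr ?exprn_gt0 ?a0 //; apply: le1 => t ht.
  rewrite mulr_ge0 ?invr_ge0 ?exprn_ge0 ?(ltW (a0 t ht)) //.
  by have := dpb t ht; rewrite ler_norml => /andP[]; lra.
- have D (t : R) : 0 <= t <= T -> is_derive t 1 (fun t => - (p t * (1 - t * r) ^+ 2))
      (- ((dp t - 2 * (r / (1 - t * r)) * p t) * (1 - t * r) ^+ 2)).
    move=> ht; have n0 : 1 - t * r != 0 by rewrite gt_eqF // a0.
    have Da := is_derive_affine r t.
    have DD := is_deriveN (is_deriveM (pd t ht) (is_deriveM Da Da)).
    have E : (fun t : R => - (p t * (1 - t * r) ^+ 2)) =
        - (p * ((fun t : R => 1 - t * r) * (fun t : R => 1 - t * r))).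
      by apply/funext => s /=; rewrite expr2.
    rewrite E; apply: (is_derive_eq DD); rewrite /GRing.scale /=.
    rewrite -[(_ * _) t]/((1 - t * r) * (1 - t * r)).
    by field.
  have := ge0_derive_le T0 D; rewrite mul0r subr0 expr1n mulr1 lerN2 => le1.
  rewrite ler_pdivlMr ?exprn_gt0 ?a0 //; apply: le1 => t ht.
  rewrite oppr_ge0 mulr_le0_ge0 ?exprn_ge0 ?(ltW (a0 t ht)) //.
  by have := dpb t ht; rewrite ler_norml => /andP[]; lra.
Qed.

(** The second antiderivative of 2 r^2 / (1 - t r)^3 vanishing to second order
    at 0 is 1 / (1 - t r) - 1 - t r, which equals r^2 / (1 - r) at t = 1. *)
Lemma sc_gradient_bound (R : realType) (m dm ddm : R -> R) (r c : R) :
  0 < r < 1 ->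
  (forall t : R, 0 <= t <= 1 -> is_derive t 1 m (dm t)) ->
  (forall t : R, 0 <= t <= 1 -> is_derive t 1 dm (ddm t)) ->
  (forall t : R, 0 <= t <= 1 -> ddm t <= c * (2 * r ^+ 2 / (1 - t * r) ^+ 3)) ->
  m 1 - m 0 - dm 0 <= c * (r ^+ 2 / (1 - r)).
Proof.
move=> /andP[r0 r1] md dmd bound.
have n0 (t : R) : 0 <= t <= 1 -> 1 - t * r != 0.
  by move=> /andP[t0 t1]; rewrite gt_eqF // subr_gt0 (le_lt_trans _ r1) // ler_piMl // ltW.
have Did (t : R) : is_derive t 1 (fun t : R => t) 1 by exact: is_derive_id.
have Dc (k t : R) : is_derive t 1 (fun _ : R => k) 0 by exact: is_derive_cst.
have D1 (t : R) : 0 <= t <= 1 -> is_derive t 1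
    (fun t => c * ((1 - t * r)^-1 - t * r) - (m t - t * dm 0))
    (c * (r / (1 - t * r) ^+ 2 - r) - (dm t - dm 0)).
  move=> ht; have D := is_deriveB
    (is_deriveZ c (is_deriveB (is_derive_inv_affine (n0 t ht)) (is_deriveM (Did t) (Dc r t))))
    (is_deriveB (md t ht) (is_deriveM (Did t) (Dc (dm 0) t))).
  apply: (is_derive_eq D).
  by rewrite !scaler0 !add0r /GRing.scale /= !mulr1.
have D2 (t : R) : 0 <= t <= 1 -> is_derive t 1
    (fun t => c * (r / (1 - t * r) ^+ 2 - r) - (dm t - dm 0))
    (c * (2 * r ^+ 2 / (1 - t * r) ^+ 3) - ddm t).
  move=> ht; have D := is_deriveB
    (is_deriveZ c (is_deriveB (is_derive_inv_affine2 (n0 t ht)) (Dc r t)))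
    (is_deriveB (dmd t ht) (Dc (dm 0) t)).
  by apply: (is_derive_eq D); rewrite !subr0.
have := ge0_second_derive ler01 D1 D2; rewrite !mul0r !mul1r !subr0 => le1.
have : c * 1^-1 - m 0 <= c * ((1 - r)^-1 - r) - (m 1 - dm 0).
  apply: le1 => [t ht|]; first by rewrite subr_ge0 bound.
  by rewrite expr1n divr1 !subrr mulr0 subr0.
rewrite invr1 mulr1 => le2.
have -> : c * (r ^+ 2 / (1 - r)) = c * ((1 - r)^-1 - r) - c.
  have := n0 1; rewrite ler01 lexx mul1r => /(_ isT) rn.
  by field.
move: le2; lra.
Qed.

(** The second antiderivative of (r / (1 - t r))^2 vanishing to second order at
    0 is - t r - ln (1 - t r). *)
Lemma sc_value_bound (R : realType) (m dm ddm : R -> R) (T r : R) :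
  0 <= T -> 0 < r -> T * r < 1 ->
  (forall t, 0 <= t <= T -> is_derive t 1 m (dm t)) ->
  (forall t, 0 <= t <= T -> is_derive t 1 dm (ddm t)) ->
  (forall t, 0 <= t <= T -> ddm t <= (r / (1 - t * r)) ^+ 2) ->
  m T <= m 0 + T * dm 0 - T * r - ln (1 - T * r).
Proof.
move=> T0 r0 Tr md dmd bound.
have a0 (t : R) : 0 <= t <= T -> 0 < 1 - t * r.
  by move=> /andP[_ tT]; rewrite subr_gt0 (le_lt_trans _ Tr) // ler_wpM2r // ltW.
have n0 (t : R) : 0 <= t <= T -> 1 - t * r != 0 by move=> /a0 /lt0r_neq0.
have Did (t : R) : is_derive t 1 (fun t : R => t) 1 by exact: is_derive_id.
have Dc (k t : R) : is_derive t 1 (fun _ : R => k) 0 by exact: is_derive_cst.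
have D1 (t : R) : 0 <= t <= T -> is_derive t 1
    (fun t => t * (dm 0 - r) - ln (1 - t * r) - m t)
    ((dm 0 - r) + r / (1 - t * r) - dm t).
  move=> ht; have D := is_deriveB (is_deriveB (is_deriveM (Did t) (Dc (dm 0 - r) t))
    (is_derive_ln_affine (a0 t ht))) (md t ht).
  apply: (is_derive_eq D).
  by rewrite !scaler0 !add0r /GRing.scale /= !mulr1 opprK.
have D2 (t : R) : 0 <= t <= T -> is_derive t 1
    (fun t => (dm 0 - r) + r / (1 - t * r) - dm t)
    ((r / (1 - t * r)) ^+ 2 - ddm t).
  move=> ht; have D := is_deriveB (is_deriveD (Dc (dm 0 - r) t)
    (is_deriveZ r (is_derive_inv_affine (n0 t ht)))) (dmd t ht).
  apply: (is_derive_eq D); rewrite add0r /GRing.scale /= expr_div_n.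
  by congr (_ - _); rewrite mulrA expr2.
have := ge0_second_derive T0 D1 D2; rewrite !mul0r !subr0 ln1 !sub0r oppr0 sub0r => le1.
have : - m 0 <= T * (dm 0 - r) - ln (1 - T * r) - m T.
  apply: le1 => [t ht|]; first by rewrite subr_ge0 bound.
  by rewrite divr1 subrK subrr.
rewrite mulrBr; lra.
Qed.

(** * Self-concordant functions along a segment *)

Lemma segment_hessian (R : realType) n (dom : set 'cV[R]_n) (f : 'cV[R]_n -> R) x d (T r : R) :
  sc_function dom f -> 0 <= T -> (forall t, 0 <= t <= T -> dom (x + t *: d)) ->
  0 < r -> T * r < 1 -> dot d (hessian f x *m d) <= r ^+ 2 ->
  dot d (hessian f (x + T *: d) *m d) <= (r / (1 - T * r)) ^+ 2.
Proof.
move=> hf T0 seg r0 Tr hr; have [oA _ cf _ _ _ _] := hf.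
apply: (@sc_growth R (fun t => dot d (hessian f (x + t *: d) *m d))
  (fun t => third_form f (x + t *: d) d d d) T r T0 _ _ _ r0 _ Tr).
- by move=> t /seg; exact: line_derive3.
- by move=> t /seg; exact: hessian_psd.
- move=> t /seg /(third_form_mixed d d hf).
  by rewrite -mulrA -exprS.
- by rewrite scale0r addr0.
Qed.

Lemma segment_value (R : realType) n (dom : set 'cV[R]_n) (f : 'cV[R]_n -> R) x d (T r : R) :
  sc_function dom f -> 0 <= T -> (forall t, 0 <= t <= T -> dom (x + t *: d)) ->
  0 < r -> T * r < 1 -> dot d (hessian f x *m d) <= r ^+ 2 ->
  f (x + T *: d) <= f x + T * dot d (gradient f x) - T * r - ln (1 - T * r).
Proof.
move=> hf T0 seg r0 Tr hr; have [oA _ cf _ _ _ _] := hf.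
have := @sc_value_bound R (fun t => f (x + t *: d))
  (fun t => dot d (gradient f (x + t *: d)))
  (fun t => dot d (hessian f (x + t *: d) *m d)) T r T0 r0 Tr.
rewrite scale0r addr0; apply => t ht.
- by apply: line_derive1 cf _; exact: seg.
- by apply: line_derive2 cf _; exact: seg.
- have [t0 tT] := andP ht.
  apply: (segment_hessian hf t0) => //; last by rewrite (le_lt_trans _ Tr) // ler_wpM2r // ltW.
  by move=> s /andP[s0 st]; apply: seg; rewrite s0 (le_trans st).
Qed.

(** The unit ball of the local norm lies in the domain: f stays bounded on the
    part of the segment inside the domain, so that closed sublevel sets keep
    its endpoint inside as well. *)
Lemma segment_in_dom (R : realType) n (dom : set 'cV[R]_n) (f : 'cV[R]_n -> R) x d (T r : R) :
  sc_function dom f -> dom x -> 0 <= T -> 0 < r -> T * r < 1 ->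
  dot d (hessian f x *m d) <= r ^+ 2 ->
  forall t, 0 <= t <= T -> dom (x + t *: d).
Proof.
move=> hf domx T0 r0 Tr hr; have [oA _ cf _ _ closed_sub _] := hf.
pose S := [set t : R | 0 <= t <= T /\ forall u, 0 <= u <= t -> dom (x + u *: d)].
have S0 : S 0.
  split=> [|u]; first by rewrite lexx.
  by rewrite -eq_le => /eqP <-; rewrite scale0r addr0.
have hasS : has_sup S.
  by split; [exists 0 | exists T => t [/andP[]]].
pose s := sup S.
have s0 : 0 <= s by exact: sup_upper_bound S0.
have sT : s <= T by apply: ge_sup; [exists 0 | move=> t [/andP[]]].
have below u : 0 <= u < s -> dom (x + u *: d).
  move=> /andP[u0 us]; have su : 0 < s - u by rewrite subr_gt0.
  have [t [_ domt] ut] := sup_adherent su hasS.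
  by apply: domt; rewrite u0 /=; move: ut; rewrite -/s subKr => /ltW.
(* c bounds the model value, and hence f, uniformly on the part before s. *)
pose g := dot d (gradient f x).
pose c := f x + T * `|g| - ln (1 - T * r).
have sub u : 0 <= u < s -> f (x + u *: d) <= c.
  move=> /andP[u0 us]; have uT : u <= T by rewrite (le_trans (ltW us)).
  have ur : u * r < 1 by rewrite (le_lt_trans _ Tr) // ler_wpM2r // ltW.
  have := segment_value hf u0 _ r0 ur hr.
  move=> h; have {h} : f (x + u *: d) <= f x + u * g - u * r - ln (1 - u * r).
    by apply: h => v /andP[v0 vu]; apply: below; rewrite v0 (le_lt_trans vu).
  move=> h; apply: le_trans h _; rewrite /c.
  have ug : u * g <= T * `|g|.
    apply: (@le_trans _ _ (u * `|g|)); first by rewrite ler_wpM2l // ler_norm.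
    by rewrite ler_wpM2r.
  have ur0 : 0 <= u * r by rewrite mulr_ge0 // ltW.
  have lnle : ln (1 - T * r) <= ln (1 - u * r).
    by rewrite ler_ln ?posrE ?subr_gt0 // lerB // ler_wpM2r // ltW.
  by move: ug ur0 lnle; clear; lra.
have ends : dom (x + s *: d).
  have [->|sn0] := eqVneq s 0; first by rewrite scale0r addr0.
  have sp : 0 < s by rewrite lt0r sn0.
  apply: contrapT => nd.
  have oC : open (~` [set y | dom y /\ f y <= c]) by exact: closed_openC.
  have /(near_line oC) : (~` [set y | dom y /\ f y <= c]) (x + s *: d).
    by move=> [].
  rewrite -[X in X -> _]/(nbhs s _) => /nbhs_ballP[e /= e0 he].
  pose m := Num.min (e / 2) s.
  have m0 : 0 < m by rewrite lt_min sp divr_gt0.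
  have me : m < e by rewrite gt_min ltr_pdivrMr // ltr_pMr // ltr1n.
  have ms : m <= s by rewrite ge_min lexx orbT.
  apply: (he (s - m)).
    by rewrite -ball_normE /ball_ /= subKr gtr0_norm.
  by split; [apply: below | apply: sub]; rewrite subr_ge0 ms ltrBlDr ltrDl.
(* If s < T, openness of dom lets the segment continue beyond s. *)
have [sltT|Tles] := ltP s T; last first.
  move=> t /andP[t0 tT]; have [ts|st] := ltP t s; first by apply: below; rewrite t0.
  by have -> : t = s by apply/eqP; rewrite eq_le st (le_trans tT).
have /nbhs_ballP[e /= e0 he] := near_line oA ends.
pose m := Num.min (e / 2) (T - s).
have m0 : 0 < m by rewrite lt_min subr_gt0 sltT divr_gt0.
have me : m < e by rewrite gt_min ltr_pdivrMr // ltr_pMr // ltr1n.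
have mT : s + m <= T by rewrite -lerBrDl ge_min lexx orbT.
have : S (s + m).
  split=> [|u /andP[u0 um]]; first by rewrite mT andbT addr_ge0 // ltW.
  have [us|su] := ltP u s; first by apply: below; rewrite u0.
  apply: he; rewrite -ball_normE /ball_ /= distrC ger0_norm ?subr_ge0 //.
  by rewrite (le_lt_trans _ me) // lerBlDl.
move=> /(sup_upper_bound hasS); rewrite -/s => contra.
by move: contra m0; rewrite gerDl leNgt => /negP.
Qed.

(** Here the third derivative is taken once along d and twice along v. *)
Lemma segment_metric (R : realType) n (dom : set 'cV[R]_n) (f : 'cV[R]_n -> R) x d v (T r : R) :
  sc_function dom f -> dom x -> 0 <= T -> 0 < r -> T * r < 1 ->
  dot d (hessian f x *m d) <= r ^+ 2 ->
  let q y := dot v (hessian f y *m v) in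
  (1 - T * r) ^+ 2 * q x <= q (x + T *: d) /\
  q (x + T *: d) <= q x / (1 - T * r) ^+ 2.
Proof.
move=> hf domx T0 r0 Tr hr q; have [oA _ cf _ _ _ _] := hf.
have seg := segment_in_dom hf domx T0 r0 Tr hr.
have := @sc_metric_bounds R (fun t => q (x + t *: d))
  (fun t => third_form f (x + t *: d) d v v) T r T0.
rewrite scale0r addr0; apply => // t ht.
- by apply: line_derive3 cf _; exact: seg.
- by apply: hessian_psd hf _; exact: seg.
- apply: le_trans (third_form_mixed d v hf (seg t ht)) _.
  rewrite ler_wpM2r ?sqr_ge0 // ler_pM2l //.
  have [t0 tT] := andP ht.
  apply: (segment_hessian hf t0) => //; last by rewrite (le_lt_trans _ Tr) // ler_wpM2r // ltW.
  by move=> s /andP[s0 st]; apply: seg; rewrite s0 (le_trans st).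
Qed.

(** The error of the linear model of the gradient, integrated twice from the
    mixed third derivative in directions d, d and w. *)
Lemma segment_gradient (R : realType) n (dom : set 'cV[R]_n) (f : 'cV[R]_n -> R) x d w (r : R) :
  sc_function dom f -> dom x -> 0 < r < 1 ->
  dot d (hessian f x *m d) <= r ^+ 2 ->
  dot w (gradient f (x + d)) <= dot w (gradient f x + hessian f x *m d) +
    Num.sqrt (dot w (hessian f x *m w)) * (r ^+ 2 / (1 - r)).
Proof.
move=> hf domx /andP[r0 r1] hr; have [oA _ cf _ _ _ _] := hf.
have r1' : 1 * r < 1 by rewrite mul1r.
have seg := segment_in_dom hf domx ler01 r0 r1' hr.
have sym : dot d (hessian f x *m w) = dot w (hessian f x *m d).
  by rewrite dotC /dot trmx_mul (hessian_sym oA cf domx) mulmxA.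
have rr : 0 < r < 1 by rewrite r0.
have bound y0 y1 : x + (0 : R) *: d = y0 -> x + (1 : R) *: d = y1 ->
    (forall t : R, 0 <= t <= 1 -> third_form f (x + t *: d) d d w <=
      Num.sqrt (dot w (hessian f x *m w)) * (2 * r ^+ 2 / (1 - t * r) ^+ 3)) ->
    dot w (gradient f y1) - dot w (gradient f y0) - dot d (hessian f y0 *m w) <=
    Num.sqrt (dot w (hessian f x *m w)) * (r ^+ 2 / (1 - r)).
  move=> <- <-; apply: (@sc_gradient_bound R (fun t => dot w (gradient f (x + t *: d)))
    (fun t => dot d (hessian f (x + t *: d) *m w)) _ r _ rr) => t ht.
    by apply: line_derive2 cf _; exact: seg.
  by apply: line_derive3 cf _; exact: seg.
rewrite dotDr -sym -lerBlDl opprD addrA; apply: bound.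
- by rewrite scale0r addr0.
- by rewrite scale1r.
move=> t ht.
have [t0 t1] := andP ht.
have tr : t * r < 1 by rewrite (le_lt_trans _ r1) // ler_piMl // ltW.
have a0 : 0 < 1 - t * r by rewrite subr_gt0.
have qw := (segment_metric w hf domx t0 r0 tr hr).2.
have qd : dot d (hessian f (x + t *: d) *m d) <= (r / (1 - t * r)) ^+ 2.
  by apply: (segment_hessian hf t0) => // s /andP[s0 st]; apply: seg; rewrite s0 (le_trans st).
rewrite (third_formC23 _ _ _ oA cf (seg t ht)) (third_formC12 _ _ _ oA cf (seg t ht)).
set X := third_form _ _ _ _ _.
have hX : X ^+ 2 <= _ := third_form_mixed w d hf (seg t ht).
have q0 := hessian_psd w hf domx.
have B0 : 0 <= Num.sqrt (dot w (hessian f x *m w)) * (2 * r ^+ 2 / (1 - t * r) ^+ 3).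
  by rewrite mulr_ge0 ?sqrtr_ge0 // divr_ge0 ?exprn_ge0 ?(ltW a0) // mulr_ge0 // sqr_ge0.
apply: le_trans (ler_norm _) _.
rewrite -ler_sqr ?nnegrE // real_normK ?num_real //; apply: le_trans hX _.
rewrite exprMn sqr_sqrtr //.
have -> : dot w (hessian f x *m w) * (2 * r ^+ 2 / (1 - t * r) ^+ 3) ^+ 2 =
    4 * (dot w (hessian f x *m w) / (1 - t * r) ^+ 2) * ((r / (1 - t * r)) ^+ 2) ^+ 2.
  by move: a0; clear; set z := dot _ _ => /lt0r_neq0 a0; field.
have qw0 := hessian_psd w hf (seg t ht).
have qd0 := hessian_psd d hf (seg t ht).
apply: ler_pM.
- by apply: mulr_ge0; last exact: qw0.
- exact: sqr_ge0.
- by rewrite ler_pM2l.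
- by apply: lerXn2r; [exact: qd0 | exact: sqr_ge0 | exact: qd].
Qed.

(** * The Newton decrement after a unit step *)

Lemma positive_spectrum_unit (R : realType) n (H : 'M[R]_n) (sigma : nat -> R) :
  positive_spectrum H sigma -> H \in unitmx.
Proof.
case=> chH mono sn0; rewrite unitmxE unitfE.
have : (char_poly H)`_0 != 0.
  rewrite -horner_coef0 chH horner_prod prodf_seq_neq0; apply/allP => i.
  rewrite mem_index_iota => /andP[i1 iN]; rewrite !hornerE /= oppr_eq0 gt_eqF //.
  by apply: lt_le_trans sn0 _; apply: mono; rewrite ?i1 // -ltnS.
by rewrite char_poly_det mulf_eq0 negb_or => /andP[].
Qed.

(** With w = H(y)^-1 g(y), the squared decrement at y is both w^T g(y), which
    the model bound and the gradient bound control by |w|_x, and |w|_y^2, which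
    dominates (1 - r)^2 |w|_x^2. *)
Lemma decrement_unit_step (R : realType) n (dom : set 'cV[R]_n) (f : 'cV[R]_n -> R)
    x y d (r c : R) :
  sc_function dom f -> dom x -> y = x + d -> 0 < r < 1 ->
  dot d (hessian f x *m d) <= r ^+ 2 -> hessian f y \in unitmx -> 0 <= c ->
  (forall w, dot w (gradient f x + hessian f x *m d) <=
     Num.sqrt (dot w (hessian f x *m w)) * c) ->
  newton_decrement f y <= (c + r ^+ 2 / (1 - r)) / (1 - r).
Proof.
move=> hf domx hy hr qd uH c0 model; have /andP[r0 r1] := hr.
have r1' : 1 * r < 1 by rewrite mul1r.
have a0 : 0 < 1 - r by rewrite subr_gt0.
rewrite /newton_decrement; set w := invmx _ *m _.
have Hw : hessian f y *m w = gradient f y by rewrite mulKVmx.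
clearbody w.
have y1 : y = x + (1 : R) *: d by rewrite hy scale1r.
have domy : dom y.
  by rewrite y1; apply: (segment_in_dom hf domx ler01 r0 r1' qd); rewrite ler01 lexx.
have metric : (1 - r) ^+ 2 * dot w (hessian f x *m w) <= dot w (gradient f y).
  rewrite -Hw y1 -[in leLHS](mul1r r).
  exact: (segment_metric w hf domx ler01 r0 r1' qd).1.
have grad : dot w (gradient f y) <= dot w (gradient f x + hessian f x *m d) +
    Num.sqrt (dot w (hessian f x *m w)) * (r ^+ 2 / (1 - r)).
  by rewrite hy; exact: (segment_gradient w hf domx hr qd).
have psdy : 0 <= dot w (gradient f y) by rewrite -Hw; exact: (hessian_psd w hf domy).
move: metric grad (model w) psdy (hessian_psd w hf domx).
rewrite [dot (gradient _ _) _]dotC.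
move: (dot w (gradient f y)) (dot w (gradient f x + _)) => L2 M.
move: (dot w (hessian f x *m w)) => q; clear - r0 a0 c0.
move=> qL LM Mc L20 q0.
have sL0 := sqrtr_ge0 L2; have sq0 := sqrtr_ge0 q.
have sL2 : Num.sqrt L2 ^+ 2 = L2 by rewrite sqr_sqrtr.
have sq2 : Num.sqrt q ^+ 2 = q by rewrite sqr_sqrtr.
have sqL : (1 - r) * Num.sqrt q <= Num.sqrt L2.
  rewrite -ler_sqr ?nnegrE //; last by rewrite mulr_ge0 // ltW.
  by rewrite exprMn sq2 sL2.
have [L_eq0|Ln0] := eqVneq (Num.sqrt L2) 0.
  by rewrite L_eq0 divr_ge0 ?(ltW a0) // addr_ge0 // divr_ge0 ?(ltW a0) // sqr_ge0.
have Lp : 0 < Num.sqrt L2 by rewrite lt0r Ln0.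
pose K := c + r ^+ 2 / (1 - r).
have K0 : 0 <= K by rewrite addr_ge0 // divr_ge0 ?(ltW a0) // sqr_ge0.
have LK : L2 <= Num.sqrt q * K.
  by rewrite /K mulrDr; apply: le_trans LM _; rewrite lerD2r.
rewrite -/K ler_pdivlMr // -(ler_pM2l Lp) mulrA -expr2 sL2.
apply: (@le_trans _ _ (Num.sqrt q * K * (1 - r))).
  by rewrite ler_wpM2r // ltW.
by rewrite mulrAC ler_wpM2r // mulrC.
Qed.

(** * The line search *)

Lemma neg_ln1B_le (R : realType) (y : R) : 0 <= y <= 1 / 2 ->
  - y - ln (1 - y) <= y ^+ 2 / 2 + y ^+ 3.
Proof.
move=> /andP[y0 y1].
have a0 (t : R) : 0 <= t <= y -> 0 < 1 - t * 1 by lra.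
have Did (t : R) : is_derive t 1 (fun t : R => t) 1 by exact: is_derive_id.
pose F (t : R) := t ^+ 2 / 2 + t ^+ 3 + t + ln (1 - t * 1).
pose dF (t : R) := t + 3 * t ^+ 2 + 1 - 1 / (1 - t * 1).
have D (t : R) : 0 <= t <= y -> is_derive t 1 F (dF t).
  move=> ht.
  have D2 := is_deriveM (Did t) (Did t).
  have D3 := is_deriveM (Did t) D2.
  have DD := is_deriveD (is_deriveD (is_deriveD (is_deriveZ 2^-1 D2) D3) (Did t))
    (is_derive_ln_affine (a0 t ht)).
  have E : F = 2^-1 \*: ((fun t : R => t) * (fun t : R => t)) +
      (fun t : R => t) * ((fun t : R => t) * (fun t : R => t)) +
      (fun t : R => t) + (fun t : R => ln (1 - t * 1)).
    apply/funext => s; rewrite /F.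
    by rewrite -[RHS]/(2^-1 * (s * s) + s * (s * s) + s + ln (1 - s * 1)) mulrC !exprS expr0 mulr1.
  rewrite E; apply: (is_derive_eq DD); rewrite /dF /GRing.scale /=.
  rewrite -[(_ * _) t]/(t * t).
  by field; move: (a0 t ht); rewrite mulr1 => /lt0r_neq0.
have Fle : F 0 <= F y.
  apply: (ge0_derive_le y0 D) => t ht; rewrite /dF.
  have p := a0 t ht; rewrite subr_ge0 ler_pdivrMr //.
  move: ht => /andP[t0 ty]; have t1 : t <= 1 / 2 by rewrite (le_trans ty).
  clear - t0 t1; nra.
have F0 : F 0 = 0 by rewrite /F [0 * 1]mul0r subr0 ln1; field.
by move: Fle; rewrite F0 /F mulr1; lra.
Qed.

Lemma ln1D_le (R : realType) (y : R) : 0 <= y ->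
  ln (1 + y) <= y - y ^+ 2 / (1 + y) / 2.
Proof.
move=> y0.
have a0 (t : R) : 0 <= t <= y -> 0 < 1 - t * (-1) by lra.
have Did (t : R) : is_derive t 1 (fun t : R => t) 1 by exact: is_derive_id.
pose F (t : R) := t - t * t * (1 - t * (-1))^-1 * 2^-1 - ln (1 - t * (-1)).
pose dF (t : R) := (t / (1 - t * (-1))) ^+ 2 / 2.
have D (t : R) : 0 <= t <= y -> is_derive t 1 F (dF t).
  move=> ht; have n0 := lt0r_neq0 (a0 t ht).
  have D2 := is_deriveM (is_deriveM (Did t) (Did t)) (is_derive_inv_affine n0).
  have DD := is_deriveB (is_deriveB (Did t) (is_deriveZ 2^-1 D2)) (is_derive_ln_affine (a0 t ht)).
  have E : F = (fun t : R => t) - 2^-1 \*: ((fun t : R => t) * (fun t : R => t) *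
        (fun t => (1 - t * (-1))^-1))
      - (fun t : R => ln (1 - t * (-1))).
    apply/funext => s; rewrite /F.
    by rewrite -[RHS]/(s - 2^-1 * (s * s * (1 - s * (-1))^-1) - ln (1 - s * (-1))) [2^-1 * _]mulrC.
  rewrite E; apply: (is_derive_eq DD); rewrite /dF /GRing.scale /=.
  rewrite -[(_ * _) t]/(t * t).
  by field.
have Fle : F 0 <= F y.
  by apply: (ge0_derive_le y0 D) => t ht; rewrite /dF divr_ge0 // sqr_ge0.
have F0 : F 0 = 0 by rewrite /F !mul0r !subr0 ln1 subrr.
move: Fle; rewrite F0 /F mulrN1 opprK -[y * y]expr2; lra.
Qed.

Lemma line_search_model (R : realType) n (dom : set 'cV[R]_n) (f : 'cV[R]_n -> R)
    x d (delta t : R) :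
  sc_function dom f -> dom x -> 0 < delta -> 0 <= t -> t * delta < 1 ->
  dot (gradient f x) d = - delta ^+ 2 -> dot d (hessian f x *m d) <= delta ^+ 2 ->
  dom (x + t *: d) /\
  f (x + t *: d) <= f x - t * delta ^+ 2 - t * delta - ln (1 - t * delta).
Proof.
move=> hf domx d0 t0 td gd qd.
have seg := segment_in_dom hf domx t0 d0 td qd.
split; first by apply: seg; rewrite t0 lexx.
by rewrite -[- (t * _)]mulrN -gd dotC; exact: (segment_value hf t0 seg d0 td qd).
Qed.

Lemma armijoP (R : realType) n (dom : set 'cV[R]_n) (f : 'cV[R]_n -> R) alpha x d (t : R) :
  armijo dom f alpha x d t <->
  dom (x + t *: d) /\
  f (x + t *: d) <= f x + alpha * t * dot (gradient f x) d.
Proof.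
rewrite /armijo /ext; split.
  by case: ifPn => [/set_mem domt|_]; rewrite ?lee_fin // leye_eq.
by move=> [/mem_set -> le]; rewrite lee_fin.
Qed.

(** Armijo's condition holds at t' = 1 / (1 + delta) and, by convexity, at every
    smaller step, so backtracking stops above beta * t'. *)
Lemma backtracking_decrease (R : realType) n (dom : set 'cV[R]_n) (f : 'cV[R]_n -> R)
    alpha beta x d (delta t : R) :
  sc_function dom f -> dom x -> 0 < alpha < 1 / 2 -> 0 < beta < 1 -> 0 < delta ->
  d != 0 ->
  dot (gradient f x) d = - delta ^+ 2 -> dot d (hessian f x *m d) <= delta ^+ 2 ->
  backtracking dom f alpha beta x d t ->
  dom (x + t *: d) /\
  f (x + t *: d) - f x <= - (alpha * beta * (delta ^+ 2 / (1 + delta))).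
Proof.
move=> hf domx /andP[al0 al1] /andP[be0 be1] de0 dn0 gd qd.
have [_ _ _ cvx _ _ _] := hf.
pose t' := (1 + delta)^-1.
have d1 : 0 < 1 + delta by rewrite addr_gt0.
have t'0 : 0 < t' by rewrite invr_gt0.
have t'd : t' * delta < 1 by rewrite mulrC ltr_pdivrMr // mul1r ltrDr.
have [domt' ft'] := line_search_model hf domx de0 (ltW t'0) t'd gd qd.
have arm' : f (x + t' *: d) <= f x - alpha * t' * delta ^+ 2.
  apply: le_trans ft' _.
  have -> : 1 - t' * delta = t' by rewrite /t'; field; rewrite gt_eqF.
  rewrite lnV ?posrE // opprK.
  have := ln1D_le (ltW de0).
  have -> : delta - delta ^+ 2 / (1 + delta) / 2 =
      t' * delta ^+ 2 + t' * delta - t' * delta ^+ 2 / 2.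
    by rewrite /t'; field; rewrite gt_eqF.
  have : 0 <= t' * delta ^+ 2 by rewrite mulr_ge0 ?sqr_ge0 // ltW.
  have -> : alpha * t' * delta ^+ 2 = alpha * (t' * delta ^+ 2) by rewrite -mulrA.
  move: (t' * delta ^+ 2) (f x) (ln _) (t' * delta) => A F L B A0 LB.
  by clear - al1 A0 LB; nra.
have small s : 0 < s <= t' -> armijo dom f alpha x d s.
  move=> /andP[s0 st']; apply/armijoP.
  have sd : s * delta < 1 by rewrite (le_lt_trans _ t'd) // ler_wpM2r // ltW.
  have [doms _] := line_search_model hf domx de0 (ltW s0) sd gd qd.
  split => //; rewrite gd mulrN.
  move: st'; rewrite le_eqVlt => /orP[/eqP -> //|st'].
  pose th := s / t'.
  have th01 : 0 < th < 1 by rewrite divr_gt0 //= ltr_pdivrMr // mul1r.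
  have ne : x + t' *: d != x.
    by rewrite -subr_eq0 addrC addKr scaler_eq0 negb_or dn0 gt_eqF.
  have xs : th *: (x + t' *: d) + (1 - th) *: x = x + s *: d.
    rewrite scalerDr scalerA divfK ?gt_eqF // scalerBl scale1r.
    by rewrite [th *: x + _]addrC -addrA [th *: x + _]addrC subrK addrC.
  have := cvx _ _ th domt' domx ne th01; rewrite xs => /ltW h.
  apply: le_trans h _.
  have -> : alpha * s * delta ^+ 2 = th * (alpha * t' * delta ^+ 2).
    by rewrite /th; field; rewrite gt_eqF.
  move: (f x) (f (x + _)) (alpha * t' * delta ^+ 2) arm' => F F' A.
  by move=> h; move: th01 => /andP[th0 _]; clear - th0 h; nra.
case=> m [-> /armijoP[domm fm] notarm]; split => //.
have tm : beta * t' <= beta ^+ m.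
  case: m notarm {domm fm} => [_|m notarm].
    rewrite expr0 mulr_ile1 ?(ltW be0) ?(ltW be1) ?(ltW t'0) //.
    by rewrite invf_le1 // lerDl ltW.
  rewrite exprS ler_pM2l // leNgt; apply/negP => lt.
  by apply: (notarm m (ltnSn m)); apply: small; rewrite exprn_gt0 // ltW.
move: fm; rewrite gd -lerBlDl => h; apply: le_trans h _.
rewrite mulrN lerN2.
have -> : alpha * beta * (delta ^+ 2 / (1 + delta)) = alpha * (beta * t') * delta ^+ 2.
  by rewrite /t'; field; rewrite gt_eqF.
by rewrite ler_wpM2r ?sqr_ge0 // ler_pM2l.
Qed.

(** The model value at t = 1 is at most delta^2 / 2 + delta^3 - delta^2 above
    f x, and delta <= 1/2 - alpha absorbs the cubic term. *)
Lemma backtracking_unit (R : realType) n (dom : set 'cV[R]_n) (f : 'cV[R]_n -> R)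
    alpha beta x d (delta t : R) :
  sc_function dom f -> dom x -> 0 < delta -> delta <= 1 / 2 -> delta <= 1 / 2 - alpha ->
  dot (gradient f x) d = - delta ^+ 2 -> dot d (hessian f x *m d) <= delta ^+ 2 ->
  backtracking dom f alpha beta x d t -> t = 1.
Proof.
move=> hf domx de0 de1 deal gd qd [m [-> _ notarm]].
case: m notarm => [|m notarm]; first by rewrite expr0.
case: (notarm 0%N) => //; rewrite expr0; apply/armijoP.
have td : 1 * delta < 1 by lra.
have [dom1 f1] := line_search_model hf domx de0 ler01 td gd qd.
split => //; apply: le_trans f1 _; rewrite gd !mul1r mulr1.
have := @neg_ln1B_le _ delta; rewrite (ltW de0) de1 => /(_ isT).
have : 0 <= delta ^+ 2 * (1 / 2 - alpha - delta) by rewrite mulr_ge0 ?sqr_ge0 // subr_ge0.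
by move: (f x) (ln _) => F L A0 LB; clear - A0 LB; nra.
Qed.

(** * Limits *)

(** A positive lower bound on a tail, together with the minimum of the finitely
    many earlier terms, bounds the whole sequence. *)
Lemma inf_range_gt0 (R : realType) (u : nat -> R) :
  (forall k, 0 < u k <= 1) -> limn_inf u != 0 -> 0 < inf (range u).
Proof.
move=> u01 l0.
have ub : bounded_fun u.
  exists 1; split => // M M1 k _ /=; have /andP[u0 u1] := u01 k.
  by rewrite ger0_norm ?(ltW u0) // (le_trans u1) // ltW.
have infs_ge0 n : 0 <= infs u n.
  apply: lb_le_inf; first by exists (u n), n => //=.
  by move=> _ [k _ <-]; have /andP[/ltW] := u01 k.
have [n un] : exists n, 0 < infs u n.
  apply/not_existsP => neg; move: l0; rewrite limn_infE // => /eqP; apply.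
  have -> : range (infs u) = [set 0].
    apply/seteqP; split => [_ [k _ <-]|_ ->] /=.
      by apply/eqP; rewrite eq_le infs_ge0 andbT leNgt; apply/negP/neg.
    exists 0%N => //; apply/eqP; rewrite eq_le infs_ge0 andbT leNgt; apply/negP/neg.
  exact: sup1.
have hlb m : has_lbound (sdrop u m).
  by exists 0 => _ [k _ <-]; have /andP[/ltW] := u01 k.
have [c c0 cle] : exists2 c, 0 < c & forall k, c <= u k.
  have [c c0 cle] : exists2 c, 0 < c & forall k, (k < n)%N -> c <= u k.
    elim: (n) => [|m [c c0 cle]]; first by exists 1.
    have /andP[um _] := u01 m.
    exists (Num.min c (u m)); first by rewrite lt_min c0.
    move=> k; rewrite ltnS leq_eqVlt => /orP[/eqP ->|km]; rewrite ge_min.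
      by rewrite lexx orbT.
    by rewrite cle.
  exists (Num.min c (infs u n)); first by rewrite lt_min c0.
  move=> k; rewrite ge_min; have [kn|nk] := ltnP k n; first by rewrite cle.
  by apply/orP; right; apply: ge_inf => //; exists k.
apply: lt_le_trans c0 _; apply: lb_le_inf; first by exists (u 0%N), 0%N.
by move=> _ [k _ <-].
Qed.

Lemma cvg_of_limn_inf1 (R : realType) (u : nat -> R) :
  (forall k, 0 < u k <= 1) -> limn_inf u = 1 -> u m @[m --> \oo] --> (1 : R).
Proof.
move=> u01 l1.
have hlb : has_lbound (range u).
  by exists 0 => _ [k _ <-]; have /andP[/ltW] := u01 k.
have hub : has_ubound (range u).
  by exists 1 => _ [k _ <-]; have /andP[] := u01 k.
have ci : infs u @ \oo --> (1 : R).
  have c := cvg_infs_sup hub hlb.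
  by move: l1; rewrite /limn_inf (cvg_lim _ c) // => <-.
apply: (@squeeze_cvgr _ _ _ _ (infs u) (fun=> 1)); [|exact: ci|exact: cvg_cst].
near=> k; have /andP[_ ->] := u01 k; rewrite andbT.
apply: ge_inf; last by exists k => //=.
by exists 0 => _ [j _ <-]; have /andP[/ltW] := u01 j.
Unshelve. all: by end_near. Qed.

Lemma cvg0_of_contraction (R : realType) (l : nat -> R) (eta q : R) (k : nat) :
  (forall m, 0 <= l m) -> 0 <= q < 1 -> l k <= eta ->
  (forall m, l m <= eta -> l m.+1 <= q * l m) ->
  l m @[m --> \oo] --> (0 : R).
Proof.
move=> l0 /andP[q0 q1] lk step.
have geo j : l (j + k)%N <= eta /\ l (j + k)%N <= q ^+ j * l k.
  elim: j => [|j [IH1 IH2]]; first by rewrite add0n expr0 mul1r.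
  have s := step _ IH1; rewrite addSn; split.
    by apply: le_trans s _; apply: le_trans IH1; rewrite ler_piMl // ltW.
  by apply: le_trans s _; rewrite exprS -mulrA ler_wpM2l.
rewrite -(cvg_shiftn k).
have cq : (fun j => q ^+ j * l k) @ \oo --> (0 : R).
  rewrite -[X in _ --> X](mul0r (l k)); apply: cvgM; last exact: cvg_cst.
  by apply: cvg_expr; rewrite ger0_norm.
apply: (@squeeze_cvgr _ _ _ _ (fun=> 0) (fun j => q ^+ j * l k)); [|exact: cvg_cst|exact: cq].
by near=> j; rewrite l0 /=; exact: (geo j).2.
Unshelve. all: by end_near. Qed.

(** * The method *)

(** What one iteration knows about the direction d; delta^2 is g^T Q^-1 g, the
    squared decrement in the metric of the truncated Hessian Q. *)
Lemma direction_estimates (R : realType) n N (dom : set 'cV[R]_n)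
    (f : 'cV[R]_n -> R) x (sigma : nat -> R) (U : 'M[R]_(n, N)) :
  (0 < N < n)%N -> sc_function dom f -> dom x ->
  positive_spectrum (hessian f x) sigma ->
  leading_eigenvectors (hessian f x) sigma U -> gradient f x != 0 ->
  let d := - (Qinv sigma U *m gradient f x) in
  let eps := sigma n / sigma N.+1 in
  let lam := newton_decrement f x in
  exists delta : R,
    [/\ [/\ 0 < lam, 0 < delta, delta <= lam & eps * lam ^+ 2 <= delta ^+ 2], d != 0,
        dot (gradient f x) d = - delta ^+ 2,
        dot d (hessian f x *m d) <= delta ^+ 2 &
        forall w, dot w (gradient f x + hessian f x *m d) <=
          Num.sqrt (dot w (hessian f x *m w)) * ((1 - eps) * lam)].
Proof.
move=> hN hf domx hs hU g0 d eps lam; have [oA _ cf _ _ _ _] := hf.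
have symH := hessian_sym oA cf domx.
have [] := lowrank_estimates hN symH hs hU g0.
rewrite -/eps -/d; set l2 := dot _ (invmx _ *m _); set d2 := dot _ (Qinv _ _ *m _).
move=> l20 /andP[d2l d2u] /andP[q0 qd] model.
have d20 : 0 < d2 by exact: lt_le_trans q0 qd.
have lam2 : lam ^+ 2 = l2 by rewrite sqr_sqrtr // ltW.
have del2 : Num.sqrt d2 ^+ 2 = d2 by rewrite sqr_sqrtr // ltW.
exists (Num.sqrt d2); split.
- split.
  + by rewrite sqrtr_gt0.
  + by rewrite sqrtr_gt0.
  + exact: ler_wsqrtr.
  + by rewrite lam2 del2.
- by apply: contraTneq q0 => ->; rewrite mulmx0 dotE big1 ?ltxx // => i _; rewrite mxE mul0r.
- by rewrite del2 /d dotNr.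
- by rewrite del2.
- exact: model.
Qed.

Lemma eps_in_unit (R : realType) n N (H : 'M[R]_n) (sigma : nat -> R) :
  (N < n)%N -> positive_spectrum H sigma -> 0 < sigma n / sigma N.+1 <= 1.
Proof.
move=> Nn [_ mono sn0].
have le : sigma n <= sigma N.+1 by apply: mono.
have sN : 0 < sigma N.+1 by exact: lt_le_trans le.
by rewrite divr_gt0 //= ler_pdivrMr // mul1r.
Qed.

(** The hypothesis is the bound of [decrement_unit_step] for r = lam and
    c = (1 - eps) lam. *)
Lemma composite_rate (R : realFieldType) (eps lam lam' : R) :
  0 < lam < 1 -> 0 <= 1 - eps ->
  lam' <= ((1 - eps) * lam + lam ^+ 2 / (1 - lam)) / (1 - lam) ->
  lam' <= (1 - eps + lam) / (1 - lam) ^+ 2 * lam.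
Proof.
move=> /andP[l0 l1] e0 h; have a0 : 0 < 1 - lam by rewrite subr_gt0.
apply: le_trans h _.
have -> : ((1 - eps) * lam + lam ^+ 2 / (1 - lam)) / (1 - lam) =
    ((1 - eps) * (1 - lam) + lam) / (1 - lam) ^+ 2 * lam.
  by field; rewrite gt_eqF.
rewrite ler_pM2r // ler_pM2r ?invr_gt0 ?exprn_gt0 // lerD2r.
by rewrite ler_piMr // gerBl ltW.
Qed.

Lemma rate_mono (R : realFieldType) (e e' l l' : R) :
  e' <= e -> e <= 1 -> 0 <= l <= l' -> l' < 1 ->
  (1 - e + l) / (1 - l) ^+ 2 <= (1 - e' + l') / (1 - l') ^+ 2.
Proof.
move=> ee e1 /andP[l0 ll] l1.
have a0 : 0 < 1 - l' by rewrite subr_gt0.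
have b0 : 0 < 1 - l by rewrite subr_gt0 (le_lt_trans ll).
apply: ler_pM.
- by rewrite addr_ge0 // subr_ge0.
- by rewrite invr_ge0 exprn_ge0 // ltW.
- by apply: lerD => //; exact: lerB.
- rewrite lef_pV2 ?posrE ?exprn_gt0 //.
  by apply: lerXn2r; rewrite ?nnegrE ?(ltW a0) ?(ltW b0) //; exact: lerB.
Qed.

Lemma rate_lt1 (R : realFieldType) (e l : R) :
  0 < e <= 1 -> 0 <= l <= e / 4 -> (1 - e + l) / (1 - l) ^+ 2 < 1.
Proof.
move=> /andP[e0 e1] /andP[l0 le].
have a0 : 0 < 1 - l by lra.
by rewrite ltr_pdivrMr ?exprn_gt0 // mul1r; nra.
Qed.

Unset Implicit Arguments.
Set Strict Implicit.

Theorem theorem3p1 (R : realType) (n N : nat)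
  (hN : (1 <= N < n)%N)
  (dom : set 'cV[R]_n) (f : 'cV[R]_n -> R)
  (hf : sc_function dom f)
  (alpha beta : R) (halpha : 0 < alpha < 1 / 2) (hbeta : 0 < beta < 1)
  (x : nat -> 'cV[R]_n) (t : nat -> R)
  (sigma : nat -> nat -> R) (U : nat -> 'M[R]_(n, N))
  (hx0 : dom (x 0%N))
  (hsigma : forall k, positive_spectrum (hessian f (x k)) (sigma k))
  (hU : forall k, leading_eigenvectors (hessian f (x k)) (sigma k) (U k))
  (hstep : forall k, backtracking dom f alpha beta (x k)
     (- (Qinv (sigma k) (U k) *m gradient f (x k))) (t k))
  (hx : forall k,
     x k.+1 = x k - t k *: (Qinv (sigma k) (U k) *m gradient f (x k)))
  (hopt : forall k, gradient f (x k) != 0) :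
  let lambda := fun k => newton_decrement f (x k) in
  let epsk := fun k => sigma k n / sigma k N.+1 in
  let eps := limn_inf epsk in
  let eps_min := inf (range epsk) in
  let rate := fun k => (1 - epsk k + lambda k) / (1 - lambda k) ^+ 2 in
  eps != 0 ->
  exists gamma eta : R,
    [/\ 0 < gamma, 0 < eta < (3 - Num.sqrt 5) / 2 &
      forall k : nat,
        (eta < lambda k -> f (x k.+1) - f (x k) <= - gamma) /\
        (lambda k <= eta ->
          [/\ t k = 1,
              (0 < eps < 1 ->
                lambda k.+1 <=
                  (1 - eps_min + lambda k) / (1 - lambda k) ^+ 2 * lambda k
                < lambda k) &
              (eps = 1 ->
                lambda k.+1 / lambda k <= rate k /\
                rate m @[m --> \oo] --> 0)])].
Proof.
move=> lambda epsk eps eps_min rate eps_ne0.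
have /andP[al0 al1] := halpha; have /andP[be0 be1] := hbeta.
have [_ ltNn] := andP hN.
pose d k := - (Qinv (sigma k) (U k) *m gradient f (x k)).
have xS k : x k.+1 = x k + t k *: d k by rewrite hx /d scalerN.
have domx k : dom (x k).
  case: k => [//|k]; have [m [tE arm _]] := hstep k.
  by rewrite xS tE; have /armijoP[] := arm.
have epsk01 k : 0 < epsk k <= 1 by exact: eps_in_unit (hsigma k).
have em0 : 0 < eps_min by exact: inf_range_gt0.
have em_le k : eps_min <= epsk k.
  by apply: ge_inf; [exists 0 => _ [j _ <-]; have /andP[/ltW] := epsk01 j | exists k].
have em1 : eps_min <= 1 by apply: le_trans (em_le 0%N) _; have /andP[] := epsk01 0%N.
have est k := direction_estimates hN hf (domx k) (hsigma k) (hU k) (hopt k).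
have lam0 k : 0 < lambda k by have [? [[]]] := est k.
(* eta <= eps_min / 4 turns the composite rate into a contraction and keeps
   eta <= 1/4 < (3 - sqrt 5) / 2; eta <= 1/2 - alpha forces unit steps. *)
pose eta := Num.min (eps_min / 4) (1 / 2 - alpha).
have eta0 : 0 < eta by rewrite lt_min divr_gt0 //= subr_gt0.
have eta_em : eta <= eps_min / 4 by rewrite ge_min lexx.
have eta_al : eta <= 1 / 2 - alpha by rewrite ge_min lexx orbT.
have eta14 : eta <= 1 / 4 by lra.
pose q := (1 - eps_min + eta) / (1 - eta) ^+ 2.
have q1 : q < 1.
  by apply: rate_lt1; [rewrite em0 | rewrite ltW].
have q0 : 0 <= q by rewrite divr_ge0 ?sqr_ge0 //; lra.
(* d0 is a lower bound on delta as long as lambda exceeds eta. *)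
pose d0 := Num.sqrt eps_min * eta.
have d00 : 0 < d0 by rewrite mulr_gt0 // sqrtr_gt0.
pose gamma := alpha * beta * (d0 ^+ 2 / (1 + d0)).
have unit_phase k : lambda k <= eta -> t k = 1 /\ lambda k.+1 <= rate k * lambda k.
  move=> lk; have [delta [[l0 de0 del _] dn0 gd qd model]] := est k.
  have l1 : lambda k < 1 by lra.
  have tk : t k = 1.
    apply: (backtracking_unit hf (domx k) de0 _ _ gd qd (hstep k)).
      by apply: le_trans (le_trans del lk) _; apply: le_trans eta14 _; lra.
    exact: le_trans (le_trans del lk) eta_al.
  split => //; apply: composite_rate; rewrite ?l0 //.
    by rewrite subr_ge0; have /andP[] := epsk01 k.
  have xSd : x k.+1 = x k + d k by rewrite xS tk scale1r.
  have uS := positive_spectrum_unit (hsigma k.+1).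
  have qd' : dot (d k) (hessian f (x k) *m d k) <= lambda k ^+ 2.
    apply: le_trans qd _; apply: lerXn2r; [exact: (ltW de0) | exact: (ltW l0) | exact: del].
  have l01 : 0 < lambda k < 1 by rewrite l0.
  have c0 : 0 <= (1 - epsk k) * lambda k.
    by rewrite mulr_ge0 ?(ltW l0) // subr_ge0; have /andP[] := epsk01 k.
  exact: (decrement_unit_step hf (domx k) xSd l01 qd' uS c0 model).
have rate_le k : lambda k <= eta ->
    rate k <= (1 - eps_min + lambda k) / (1 - lambda k) ^+ 2 /\ rate k <= q.
  move=> lk; have l1 : lambda k < 1 by lra.
  have /andP[_ e1] := epsk01 k.
  split; apply: rate_mono => //; rewrite ?lexx ?lk ?(ltW (lam0 k)) //; lra.
exists gamma, eta; split.
- by apply: mulr_gt0; [exact: mulr_gt0 | rewrite divr_gt0 ?exprn_gt0 ?addr_gt0].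
- rewrite eta0 /=; apply: le_lt_trans eta14 _.
  have s5 : Num.sqrt 5 < 5 / 2 :> R.
    by rewrite -ltr_sqr ?nnegrE ?sqrtr_ge0 // sqr_sqrtr //; lra.
  by lra.
move=> k; split.
- move=> lk; have [delta [[l0 de0 del dee] dn0 gd qd model]] := est k.
  have [_] := backtracking_decrease hf (domx k) halpha hbeta de0 dn0 gd qd (hstep k).
  rewrite -/(d k) -xS => h; apply: le_trans h _.
  rewrite lerN2 /gamma ler_pM2l ?mulr_gt0 //.
  have dd : d0 <= delta.
    rewrite -ler_sqr ?nnegrE ?(ltW d00) ?(ltW de0) //; apply: le_trans dee.
    rewrite exprMn sqr_sqrtr ?(ltW em0) //; apply: ler_pM.
    + exact: ltW.
    + exact: sqr_ge0.
    + exact: em_le.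
    + by apply: lerXn2r; [exact: (ltW eta0) | exact: (ltW l0) | exact: ltW].
  rewrite ler_pdivrMr ?addr_gt0 // mulrAC ler_pdivlMr ?addr_gt0 //.
  rewrite -subr_ge0.
  have -> : delta ^+ 2 * (1 + d0) - d0 ^+ 2 * (1 + delta) =
      (delta - d0) * (delta + d0 + delta * d0) by ring.
  apply: mulr_ge0; first by rewrite subr_ge0.
  by apply: ltW; apply: addr_gt0; [exact: addr_gt0 | exact: mulr_gt0].
- move=> lk; have [tk step] := unit_phase k lk; have [r1 r2] := rate_le k lk.
  have l14 : lambda k <= eps_min / 4 by exact: le_trans lk eta_em.
  split => //.
  + move=> _; apply/andP; split.
      by apply: le_trans step _; rewrite ler_pM2r.
    rewrite gtr_pMl //; apply: rate_lt1; first by rewrite em0.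
    by rewrite ltW.
  + move=> eps1; split; first by rewrite ler_pdivrMr.
    have e1 : epsk m @[m --> \oo] --> (1 : R) by exact: cvg_of_limn_inf1.
    have l0 : lambda m @[m --> \oo] --> (0 : R).
      have lam_ge0 m : 0 <= lambda m by exact: ltW.
      have q01 : 0 <= q < 1 by rewrite q0.
      apply: (cvg0_of_contraction lam_ge0 q01 lk) => m lm.
      apply: le_trans (unit_phase m lm).2 _.
      exact: ler_wpM2r (lam_ge0 m) _ _ (rate_le m lm).2.
    have -> : (0 : R) = (1 - 1 + 0) / (1 - 0) ^+ 2 by rewrite subrr addr0 mul0r.
    have c1 : (fun _ : nat => (1 : R)) @ \oo --> (1 : R) by exact: cvg_cst.
    apply: cvgM; first by apply: cvgD => //; exact: cvgB.
    apply: cvgV; first by rewrite subr0 expr1n oner_neq0.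
    by rewrite expr2; under eq_fun do rewrite expr2; apply: cvgM; exact: cvgB.
Qed.
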